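(* Let $d\ge 1$, $\alpha>0$, and let $\{\omega_n\}_{n\in\mathbb{Z}^d}$ be i.i.d. real random variables with $\mathbb{E}(\omega_0^2)<\infty$. Let $H^\omega=\Delta+V^\omega$ on $\ell^2(\mathbb{Z}^d)$, where $\Delta$ is the discrete Laplacian and $V^\omega$ is multiplication by $\omega_n(1+|n|)^{-\alpha}$, and let $\mathcal{N}^\omega_L(E)$ be the number of eigenvalues (counted with multiplicity) not exceeding $E$ of the restriction $H^\omega_L$ of $H^\omega$ to the cube $\Lambda_L$. Then the integrated density of states of $H^\omega$ agrees with that of the free Laplacian: for almost every $\omega$ and all $E\in\mathbb{R}$, $$\lim_{L\to\infty}\frac{\mathcal{N}^\omega_L(E)}{(2L+1)^d}=\mathcal{N}^0(E),$$ where $\mathcal{N}^0(E)$ is the integrated density of states of the discrete Laplacian $\Delta$.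
   Context: Probability space: $\Omega=\mathbb{R}^{\mathbb{Z}^d}$ with its product Borel $\sigma$-algebra and $\mathbb{P}=\bigotimes_{n\in\mathbb{Z}^d}\mu$, where $\mu$ is a probability measure on $\mathbb{R}$; $\omega=(\omega_n)_{n\in\mathbb{Z}^d}\in\Omega$, so the $\omega_n$ are i.i.d. with common distribution $\mu$. ''Almost every $\omega$'' is with respect to $\mathbb{P}$. Operators on $\ell^2(\mathbb{Z}^d)$: $(\Delta u)(n)=\sum_{|k-n|=1}u(k)$ (sum over the $2d$ nearest neighbours $k$ of $n$, no diagonal term), and $(V^\omega u)(n)=\frac{\omega_n}{(1+|n|)^\alpha}u(n)$. Here $|\cdot|$ is a fixed norm, either the Euclidean or the $\ell^1$ norm on $\mathbb{Z}^d$, so that $|k-n|=1$ means nearest neighbours. The operator $H^\omega=\Delta+V^\omega$ is self-adjoint, with the finitely supported vectors as a core. Finite volume: $\Lambda_L=\{n=(n_1,\dots,n_d)\in\mathbb{Z}^d: |n_i|\le L,\ i=1,\dots,d\}$ for $L\in\mathbb{N}$, and $\chi_L$ is the orthogonal projection onto $\ell^2(\Lambda_L)$. Put $\Delta_L=\chi_L\Delta\chi_L$, $V^\omega_L=\chi_LV^\omega\chi_L$, $H^\omega_L=\Delta_L+V^\omega_L$, regarded as matrices of size $(2L+1)^d$ acting on $\ell^2(\Lambda_L)$. Integrated density of states of $\Delta$: $\mathcal{N}^0(E)=\langle\delta_0,E_\Delta((-\infty,E])\delta_0\rangle$, where $E_\Delta(\cdot)$ is the spectral measure of $\Delta$ and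 $\{\delta_n\}_{n\in\mathbb{Z}^d}$ is the standard basis of $\ell^2(\mathbb{Z}^d)$; equivalently, $\mathcal{N}^0(E)=\lim_{L\to\infty}(2L+1)^{-d}\,\#\{\text{eigenvalues of }\Delta_L\text{ not exceeding }E\}$, counted with multiplicity. *)

(* Defs.v *)
From HB Require Import structures.
From mathcomp Require Import all_boot all_order all_algebra.
From mathcomp Require Import all_classical all_reals all_analysis.
From mathcomp Require Import complex.

Set Implicit Arguments.
Unset Strict Implicit.
Unset Printing Implicit Defensive.

Import Order.TTheory GRing.Theory Num.Theory numFieldNormedType.Exports.

Local Open Scope classical_set_scope.
Local Open Scope ring_scope.
Local Open Scope complex_scope.

Notation site d := {ffun 'I_d -> int}.

Variant site_norm := Euclidean | Ell1.

Definition snorm (R : realType) (d : nat) (nu : site_norm) (n : site d) : R :=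
  match nu with
  | Euclidean => Num.sqrt (\sum_(i < d) ((n i)%:~R : R) ^+ 2)
  | Ell1 => \sum_(i < d) `|(n i)%:~R : R|
  end.

(* Unconditional sum of a summable real family (positive part minus negative
   part), used only for absolutely summable families. *)
Definition rsum (R : realType) (I : choiceType) (f : I -> R) : R :=
  fine (\esum_(i in [set: I]) (EFin \o f)^\+ i
        - \esum_(i in [set: I]) (EFin \o f)^\- i)%E.

Section Ell2.
Variables (R : realType) (d : nat).
Implicit Types u v : site d -> R[i].

Definition sqnorm u : \bar R :=
  (\esum_(n in [set: site d]) (complex.Re (u n) ^+ 2 + complex.Im (u n) ^+ 2)%:E)%E.

Definition ell2 u : Prop := (sqnorm u < +oo)%E.

(* Antilinear in the first argument. *)
Definition inner u v : R[i] :=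
  let w n := (u n)^* * v n in
  rsum (fun n => complex.Re (w n)) +i* rsum (fun n => complex.Im (w n)).

Definition delta (n : site d) : site d -> R[i] := fun k => (k == n)%:R.

(* An orthogonal projection of ell^2. The operators are total functions on all
   complex families; only their values on ell2 are constrained. *)
Definition orthogonal_projection (Q : (site d -> R[i]) -> site d -> R[i]) :=
  [/\ forall u, ell2 u -> ell2 (Q u),
      forall (a : R[i]) u v, ell2 u -> ell2 v ->
        Q (fun n => a * u n + v n) = (fun n => a * Q u n + Q v n),
      forall u, ell2 u -> Q (Q u) = Q u &
      forall u v, ell2 u -> ell2 v -> inner (Q u) v = inner u (Q v)].

(* The spectral measure of a bounded self-adjoint operator A: the
   projection-valued measure PE on the Borel sets of R with A = \int x dPE(x).
   For bounded A it is supported in a bounded interval, so the integrals below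
   are finite. *)
Record is_spectral_measure (A : (site d -> R[i]) -> site d -> R[i])
    (PE : set R -> (site d -> R[i]) -> site d -> R[i]) : Prop := {
  pvm_proj : forall B, measurable B -> orthogonal_projection (PE B) ;
  pvm_set0 : forall u, ell2 u -> PE set0 u = (fun=> 0) ;
  pvm_setT : forall u, ell2 u -> PE [set: R] u = u ;
  pvm_setI : forall B C u, measurable B -> measurable C -> ell2 u ->
    PE (B `&` C) u = PE B (PE C u) ;
  (* strong countable additivity *)
  pvm_bigcup : forall (F : nat -> set R) u,
    (forall k, measurable (F k)) -> trivIset setT F -> ell2 u ->
    (fun m => sqnorm (fun n =>
       PE (\bigcup_k F k) u n - \sum_(k < m) PE (F k) u n)) @ \oo --> 0%E ;
  pvm_bounded : exists M : R, forall u, ell2 u -> PE [set` `[- M, M]] u = u ;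
  pvm_integral : forall u, ell2 u ->
    inner u (A u) =
      (fine (\int[fun B => (complex.Re (inner u (PE B u)))%:E]_(x in [set: R])
               x%:E)%E)%:C
}.

Variable nu : site_norm.

Definition laplacian u : site d -> R[i] := fun n =>
  \sum_(k \in [set k : site d | snorm R nu (k - n) = 1]) u k.

Definition potential (alpha : R) (omega : site d -> R) u : site d -> R[i] :=
  fun n => (omega n / (1 + snorm R nu n) `^ alpha)%:C * u n.

Definition hamiltonian (alpha : R) (omega : site d -> R) u : site d -> R[i] :=
  fun n => laplacian u n + potential alpha omega u n.

End Ell2.

Section FiniteVolume.
Variables (R : realType) (d : nat).

Definition cube (L : nat) : set (site d) :=
  [set n | forall i, `|n i| <= L%:Z].

(* Enumeration of the cube, obtained by translating {0, ..., 2L}^d. *)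
Notation cube_index L := {ffun 'I_d -> 'I_(2 * L).+1}.

Definition cube_site (L : nat) (j : 'I_#|{: cube_index L}|) : site d :=
  [ffun i => (enum_val j i)%:Z - L%:Z].

Lemma card_cube_index (L : nat) : #|{: cube_index L}| = ((2 * L).+1 ^ d)%N.
Proof. by rewrite card_ffun !card_ord. Qed.

Lemma cube_site_inj (L : nat) : injective (@cube_site L).
Proof.
move=> j k /ffunP jk; apply: enum_val_inj; apply/ffunP => i.
by have := jk i; rewrite !ffunE => /addIr[] /val_inj.
Qed.

Lemma range_cube_site (L : nat) : range (@cube_site L) = cube L.
Proof.
apply/seteqP; split=> [n [j _ <-] i | n nL].
  rewrite ffunE ler_norml lerBlDr lerBrDr addNr lez_nat /= -PoszD lez_nat.
  have := ltn_ord (enum_val j i); move: (nat_of_ord _) => m.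
  by rewrite ltnS mul2n -addnn.
have nL0 i : 0 <= n i + L%:Z by rewrite -lerBlDr sub0r; case/ler_normlP: (nL i);
  rewrite lerNl.
pose c : cube_index L := [ffun i => inord `|(n i + L%:Z)%R|%N].
exists (enum_rank c) => //; apply/ffunP => i.
rewrite ffunE enum_rankK ffunE inordK; last first.
  rewrite -ltz_nat gez0_abs // -addn1 PoszD ltzD1 mul2n -addnn PoszD lerD2r.
  exact: le_trans (ler_norm _) (nL i).
by rewrite gez0_abs // addrK.
Qed.

(* The matrix of chi_L A chi_L on ell^2(cube L): its entries are
   <delta_n, A delta_k> = (A delta_k)(n), for n, k in the cube. *)
Definition restriction (A : (site d -> R[i]) -> site d -> R[i]) (L : nat) :
    'M[R[i]]_#|{: cube_index L}| :=
  \matrix_(j, k) A (delta R (cube_site k)) (cube_site j).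

End FiniteVolume.

(* On R[i], l <= E%:C means that l is real and at most E. The number counts
   multiplicity through the dimensions of the eigenspaces. *)
Definition eigenvalue_count (R : realType) (N : nat) (M : 'M[R[i]]_N) (E : R) :
    nat :=
  \big[addn/0%N]_(l \in [set l : R[i] | eigenvalue M l /\ l <= E%:C])
    \rank (eigenspace M l).

(* Integrated density of states <delta_0, PE(]-oo, E]) delta_0>; the inner
   product is real because PE takes values in the orthogonal projections. *)
Definition ids (R : realType) (d : nat)
    (PE : set R -> (site d -> R[i]) -> site d -> R[i]) (E : R) : R :=
  complex.Re (inner (delta R 0) (PE [set` `]-oo, E]] (delta R 0))).

(* Independence is mutual: the product rule over every finite subfamily. *)
Definition iid (dd : measure_display) (T : measurableType dd) (R : realType)
    (P : probability T R) (I : choiceType) (X : I -> {RV P >-> R}) : Prop :=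
  (forall (s : seq I) (B : I -> set R), uniq s ->
     (forall i, measurable (B i)) ->
     P (\bigcap_(i in [set` s]) (X i @^-1` B i))
       = (\prod_(i <- s) P (X i @^-1` B i))%E) /\
  (forall (i j : I) (B : set R), measurable B ->
     distribution P (X i) B = distribution P (X j) B).

(* Main.v *)
(* Let e_i be an orthonormal eigenbasis of H_L, extended by 0
   to the lattice, with eigenvalues r_i, and let Q_c be the spectral projection
   of the Laplacian D for ]-oo, c]. If r_i <= E then
     h^2 |(1 - Q_{E+h}) e_i|^2 <= |(D - r_i) e_i|^2,
   and if r_i > E then h^2 |Q_{E-h} e_i|^2 <= |(D - r_i) e_i|^2. Summing over i,
   sum_i |Q_c e_i|^2 = sum_{n in cube} |Q_c delta_n|^2 is (2L+1)^d times the
   integrated density of states of D, up to a shift of c, while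
   sum_i |(D - r_i) e_i|^2 is the squared Hilbert-Schmidt norm of D - H_L on the
   cube, which is at most twice sum_{n in cube} V_n^2 plus a boundary term of
   order L^(d-1). Hence the theorem holds at every point of continuity of the
   density of states as soon as the average of V_n^2 over the cube tends to 0.

   That average tends to 0 almost surely because its expectations along the
   cubes of size 4^k are summable in k. The density of states is continuous
   because D has no eigenfunction u in l^2: if u_a denotes the slice of u at
   first coordinate a, then phi(a, b) = <u_a, u_b> satisfies the discrete wave
   equation phi(a+1, b) + phi(a-1, b) = phi(a, b+1) + phi(a, b-1) and vanishes
   at infinity, so phi(a, a) is independent of a, hence 0. *)
Require Import Defs.
From HB Require Import structures.
From mathcomp Require Import all_boot all_order all_algebra.
From mathcomp Require Import all_classical all_reals all_analysis.
From mathcomp Require Import complex.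
From mathcomp Require Import measurable_realfun.
From mathcomp Require Import zify ring lra.

Set Implicit Arguments.
Unset Strict Implicit.
Unset Printing Implicit Defensive.

Import Order.TTheory GRing.Theory Num.Theory numFieldNormedType.Exports.

Local Open Scope classical_set_scope.
Local Open Scope ring_scope.
Local Open Scope complex_scope.

(** * Spectral cuts of a bounded symmetric operator *)

Section InnerProduct.
Variables (R : realType) (V : lmodType R).

(** Only semidefinite: Cauchy-Schwarz is also applied to the form [ip u (B v)] of a nonnegative
    symmetric operator [B]. *)
Record psd_form (f : V -> V -> R) : Prop := {
  form_sym : forall u v, f u v = f v u ;
  form_add : forall u v w, f u (v + w) = f u v + f u w ;
  form_scale : forall a u v, f u (a *: v) = a * f u v ;
  form_ge0 : forall u, 0 <= f u u
}.

Section Form.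
Variables (f : V -> V -> R) (hf : psd_form f).

Lemma formDl u v w : f (u + v) w = f u w + f v w.
Proof. by rewrite form_sym// form_add// !(form_sym hf w). Qed.

Lemma formZl a u v : f (a *: u) v = a * f u v.
Proof. by rewrite form_sym// form_scale// (form_sym hf v). Qed.

Lemma formNr u v : f u (- v) = - f u v.
Proof. by rewrite -scaleN1r form_scale// mulN1r. Qed.

Lemma formNl u v : f (- u) v = - f u v.
Proof. by rewrite form_sym// formNr (form_sym hf). Qed.

Lemma formBr u v w : f u (v - w) = f u v - f u w.
Proof. by rewrite form_add// formNr. Qed.

Lemma formBl u v w : f (u - v) w = f u w - f v w.
Proof. by rewrite formDl formNl. Qed.

Lemma form_0r u : f u 0 = 0.
Proof. by rewrite -(scale0r u) form_scale// mul0r. Qed.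

Lemma form_CauchySchwarz u v : f u v ^+ 2 <= f u u * f v v.
Proof.
have key (t : R) : 0 <= f u u - t * f u v *+ 2 + t ^+ 2 * f v v.
  have := form_ge0 hf (u - t *: v).
  rewrite formBl !formBr !formZl !form_scale// (form_sym hf v u).
  move=> /le_trans; apply.
  by rewrite le_eqVlt; apply/orP; left; apply/eqP; ring.
have [v0|vn0] := eqVneq (f v v) 0; last first.
  have vp : 0 < f v v by rewrite lt0r vn0 form_ge0.
  have := mulr_ge0 (key (f u v / f v v)) (ltW vp).
  move=> h; rewrite -subr_ge0; apply: le_trans h _.
  by rewrite le_eqVlt; apply/orP; left; apply/eqP; field.
rewrite v0 mulr0; have [->|uv0] := eqVneq (f u v) 0; first by rewrite expr0n.
(* When [f v v = 0] the quadratic is affine in [t], and this [t] would give it the value [-1]. *)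
have := key ((f u u + 1) / (f u v *+ 2)).
rewrite v0 mulr0 addr0 -mulrnAr -mulrA mulVf ?mulr1 ?mulrn_eq0//.
by rewrite opprD addrA subrr sub0r oppr_ge0 ler10.
Qed.

End Form.

Variables (ip : V -> V -> R) (hip : psd_form ip).
Hypothesis ip_eq0 : forall u, ip u u = 0 -> u = 0.

Lemma ip_inj u v : (forall w, ip u w = ip v w) -> u = v.
Proof.
move=> uv; apply/eqP; rewrite -subr_eq0; apply/eqP/ip_eq0.
by rewrite formBl// uv subrr.
Qed.

(** [P] is a bare function; symmetry and definiteness make it linear, see [cp_add] and
    [cp_scale]. *)
Record commuting_projection (A P : V -> V) : Prop := {
  cp_idem : forall u, P (P u) = P u ;
  cp_sym : forall u v, ip (P u) v = ip u (P v) ;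
  cp_comm : forall u, P (A u) = A (P u)
}.

Section CommutingProjection.
Variables (A : {linear V -> V}) (P : V -> V).
Hypothesis hP : commuting_projection A P.

Lemma cp_add u v : P (u + v) = P u + P v.
Proof.
by apply: ip_inj => w; rewrite (cp_sym hP) !formDl// !(cp_sym hP).
Qed.

Lemma cp_scale a u : P (a *: u) = a *: P u.
Proof. by apply: ip_inj => w; rewrite (cp_sym hP) !formZl// !(cp_sym hP). Qed.

Lemma cp_sub u v : P (u - v) = P u - P v.
Proof. by rewrite cp_add -scaleN1r cp_scale scaleN1r. Qed.

Lemma cp_compl : commuting_projection A (fun u => u - P u).
Proof.
split=> [u|u v|u]; last by rewrite (cp_comm hP) linearB.
- by rewrite cp_sub (cp_idem hP) subrr subr0.
- by rewrite formBl// formBr// (cp_sym hP).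
Qed.

Lemma cp_pythagoras u : ip u u = ip (P u) (P u) + ip (u - P u) (u - P u).
Proof.
rewrite (formBl hip) !(formBr hip) (form_sym hip (P u) u).
have -> : ip (P u) (P u) = ip u (P u) by rewrite (cp_sym hP) (cp_idem hP).
ring.
Qed.

Lemma cp_le u : ip (P u) (P u) <= ip u u.
Proof. by rewrite (cp_pythagoras u) lerDl form_ge0. Qed.

(** Commutation gives [ip (P u) (A (P u)) = ip (P u) (A u)], to which Cauchy-Schwarz applies. *)
Lemma gap_bound (e : R) u : 0 < e ->
  e * ip (P u) (P u) <= ip (P u) (A (P u)) ->
  e ^+ 2 * ip (P u) (P u) <= ip (A u) (A u).
Proof.
move=> e0; have -> : ip (P u) (A (P u)) = ip (P u) (A u).
  by rewrite -(cp_comm hP) -(cp_sym hP) (cp_idem hP).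
move=> le1; have := form_CauchySchwarz hip (P u) (A u).
have := form_ge0 hip (P u); have := form_ge0 hip (A u).
move: (ip (P u) (P u)) (ip (A u) (A u)) (ip (P u) (A u)) le1 => s r t le1.
move=> r0; rewrite le_eqVlt => /predU1P[<-|s0 le2]; first by rewrite mulr0.
have es0 : 0 <= e * s by rewrite mulr_ge0// ltW.
have : (e * s) ^+ 2 <= s * r by apply: le_trans le2;
  rewrite lerXn2r ?nnegrE ?(le_trans es0).
by rewrite exprMn [s ^+ 2]expr2 mulrA mulrC ler_pM2l.
Qed.

End CommutingProjection.

Section BoundedSymmetric.
Variables (B : {linear V -> V}) (s : R).
Hypothesis B_sym : forall u v, ip (B u) v = ip u (B v).
Hypothesis B_ge0 : forall u, 0 <= ip u (B u).

(** Cauchy-Schwarz for the form of [B] at [P u] and [B (P u)]; the latter is [P (B u)], so the form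
    bound applies to both vectors. *)
Lemma norm_le_of_form_le (P : V -> V) : commuting_projection B P ->
  (forall u, ip (P u) (B (P u)) <= s * ip (P u) (P u)) ->
  forall u, ip (B (P u)) (B (P u)) <= s ^+ 2 * ip (P u) (P u).
Proof.
move=> hP hs u.
have hB : psd_form (fun u v => ip u (B v)).
  split=> [x y|x y z|a x y|x//]; first by rewrite -B_sym (form_sym hip).
  - by rewrite linearD (form_add hip).
  - by rewrite linearZ (form_scale hip).
have := form_CauchySchwarz hB (P u) (B (P u)); rewrite -B_sym.
have := hs (B u); rewrite (cp_comm hP); have := hs u.
have := B_ge0 (P u); have := B_ge0 (B (P u)).
have := form_ge0 hip (B (P u)); have := form_ge0 hip (P u).
set x := ip (P u) (P u); set y := ip (B (P u)) (B (P u)).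
move: (ip (P u) (B (P u))) (ip _ (B (B (P u)))) => a b.
move=> x0; rewrite le_eqVlt => /predU1P[<- *|y0 b0 a0 ax bs yab].
  by rewrite mulr_ge0// sqr_ge0.
rewrite -(ler_pM2l y0) -expr2 (le_trans yab)//.
rewrite (le_trans (ler_pM a0 b0 ax bs))//.
by rewrite le_eqVlt; apply/orP; left; apply/eqP; ring.
Qed.

End BoundedSymmetric.

Section ZeroForm.
Variables (B : {linear V -> V}) (P : V -> V).
Hypothesis B_sym : forall u v, ip (B u) v = ip u (B v).
Hypothesis hP : commuting_projection B P.

(** At [u + B u] the form reduces to its cross terms, which add up to twice the squared norm of
    [B (P u)]. *)
Lemma form_eq0_op_eq0 : (forall u, ip (P u) (B (P u)) = 0) ->
  forall u, B (P u) = 0.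
Proof.
move=> h u; apply: ip_eq0.
have := h (u + B u); rewrite (cp_add hP) linearD (formDl hip) !(form_add hip).
rewrite !h (cp_comm hP) addr0 add0r -B_sym => /eqP.
by rewrite -mulr2n mulrn_eq0 /= => /eqP.
Qed.

End ZeroForm.

(** What is kept of the spectral projection for []-oo, c]]. These properties survive conjugation by
    translations, so that projections can be compared without a uniqueness theorem for spectral
    measures. *)
Record spectral_cut (A Q : V -> V) (c : R) : Prop := {
  cut_cp : commuting_projection A Q ;
  cut_below : forall u, ip (Q u) (A (Q u)) <= c * ip (Q u) (Q u) ;
  cut_above : forall u, let v := u - Q u in c * ip v v <= ip v (A v)
}.

Section Cuts.
Variable (A : {linear V -> V}).
Hypothesis A_sym : forall u v, ip (A u) v = ip u (A v).

Lemma cp_affine (P : V -> V) (a b : R) (B : {linear V -> V}) :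
  (forall u, B u = a *: A u + b *: u) ->
  commuting_projection A P -> commuting_projection B P.
Proof.
move=> hB hP; split; [exact: cp_idem hP|exact: cp_sym hP|] => u.
by rewrite !hB (cp_add hP) !(cp_scale hP) (cp_comm hP).
Qed.

(** [gap_bound] for [A - l] and the complementary projection, on whose range the form of [A - l] is
    at least [e]. *)
Lemma cut_above_bound Q c (e l : R) u : spectral_cut A Q c -> 0 < e ->
  l + e <= c ->
  e ^+ 2 * ip (u - Q u) (u - Q u) <= ip (A u - l *: u) (A u - l *: u).
Proof.
move=> hQ e0 lec.
pose B : {linear V -> V} := A \- (l \*: idfun)%R.
have BE v : B v = A v - l *: v by [].
have hP : commuting_projection B (fun u => u - Q u).
  apply: (cp_affine (a := 1) (b := - l)); last exact: cp_compl (cut_cp hQ).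
  by move=> v; rewrite BE scale1r scaleNr.
apply: (gap_bound hP e0); have := cut_above hQ u; rewrite BE /=.
move: (u - Q u) => v le1; rewrite (formBr hip) (form_scale hip).
rewrite lerBrDr -mulrDl (le_trans _ le1)// ler_wpM2r//.
  exact: form_ge0.
by rewrite addrC.
Qed.

(** The mirror image of [cut_above_bound]: [gap_bound] for [l - A] on the range of [Q]. *)
Lemma cut_below_bound Q c (e l : R) u : spectral_cut A Q c -> 0 < e ->
  c <= l - e ->
  e ^+ 2 * ip (Q u) (Q u) <= ip (A u - l *: u) (A u - l *: u).
Proof.
move=> hQ e0 lec.
pose B : {linear V -> V} := (l \*: idfun)%R \- A.
have BE v : B v = l *: v - A v by [].
have hP : commuting_projection B Q.
  apply: (cp_affine (a := -1) (b := l)); last exact: cut_cp hQ.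
  by move=> v; rewrite BE scaleN1r addrC.
have := @gap_bound B Q hP e u e0.
rewrite !BE -[A u - _]opprB (formNl hip _ (- _)) (formNr hip) opprK; apply.
rewrite (formBr hip) (form_scale hip) lerBrDr -lerBrDl -mulrBl.
by rewrite (le_trans (cut_below hQ u))// ler_wpM2r// form_ge0.
Qed.

Variable M : R.
Hypothesis A_ge : forall u, - M * ip u u <= ip u (A u).

(* On the range of Q, which is A-invariant, A + m has norm at most s = c + m,
   while A + m >= t = c' + m > s on the range of 1 - Q': moving A + m through
   1 - Q' gains a factor s / t each time. *)
Lemma cut_comparison Q Q' c c' : spectral_cut A Q c -> spectral_cut A Q' c' ->
  c < c' -> forall u, Q' (Q u) = Q u.
Proof.
move=> hQ hQ' cc' u.
(* [m] makes [A + m] nonnegative and [s] positive. *)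
pose m := `|M| + `|c| + 1; pose s := c + m; pose t := c' + m.
have mM : M <= m by rewrite /m -addrA (le_trans (ler_norm M))// lerDl addr_ge0.
have s0 : 0 < s.
  rewrite /s /m; have := ler_norm (- c); rewrite normrN.
  by have := normr_ge0 M; lra.
have st : s < t by rewrite ltrD2r.
have t0 : 0 < t by exact: lt_trans st.
pose B : {linear V -> V} := A \+ (m \*: idfun)%R.
have BE v : B v = A v + m *: v by [].
have B_sym v w : ip (B v) w = ip v (B w).
  by rewrite !BE (formDl hip) (form_add hip) A_sym (formZl hip) (form_scale
    hip).
have B_ge0 v : 0 <= ip v (B v).
  rewrite BE (form_add hip) (form_scale hip) -lerBlDr sub0r.
  rewrite (le_trans _ (A_ge v))// mulNr lerN2 ler_wpM2r// form_ge0//.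
have hBP P : commuting_projection A P -> commuting_projection B P.
  by apply: (cp_affine (a := 1) (b := m)) => v; rewrite BE scale1r.
have hBQ := hBP _ (cut_cp hQ).
have hBR := hBP _ (cp_compl (cut_cp hQ')).
have nB v : ip (B (Q v)) (B (Q v)) <= s ^+ 2 * ip (Q v) (Q v).
  apply: norm_le_of_form_le => // w.
  rewrite BE (form_add hip) (form_scale hip) (mulrDl c) lerD2r.
  exact: cut_below hQ w.
pose r v := v - Q' v; have rE v : r v = v - Q' v by [].
have nR v : t ^+ 2 * ip (r v) (r v) <= ip (r (B v)) (r (B v)).
  have := @gap_bound B _ hBR t (r v) t0; rewrite -!rE.
  have -> : r (r v) = r v by exact: (cp_idem hBR v).
  have -> : r (B v) = B (r v) by exact: (cp_comm hBR v).
  apply; have := cut_above hQ' v; rewrite BE /= -/(r v); move: (r v) => z cz.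
  by rewrite (form_add hip) (form_scale hip) (mulrDl c') lerD2r.
pose th := (s / t) ^+ 2.
have contr k v : ip (r (Q v)) (r (Q v)) <= th ^+ k * ip (Q v) (Q v).
  elim: k v => [|k IH] v.
    rewrite expr0 mul1r; exact: (cp_le hBR).
  have t20 : 0 < t ^+ 2 by rewrite exprn_gt0.
  (* Since [B (Q v) = Q (B v)], the induction hypothesis applies to [B v]. *)
  rewrite -(ler_pM2l t20) (le_trans (nR _))// -(cp_comm hBQ).
  rewrite (le_trans (IH _))// (cp_comm hBQ).
  apply: le_trans (ler_wpM2l _ (nB v)) _; first by rewrite exprn_ge0// sqr_ge0.
  rewrite (exprSr th) le_eqVlt; move: (th ^+ k) => z; rewrite /th.
  by apply/orP; left; apply/eqP; field; rewrite gt_eqF.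
have th1 : th < 1.
  by rewrite /th expr_lt1// ?ltr_pdivrMr// ?mul1r// divr_ge0// ltW.
suff : r (Q u) = 0 by move=> /eqP; rewrite rE subr_eq0 eq_sym => /eqP.
apply: ip_eq0; apply/eqP; rewrite eq_le form_ge0// andbT leNgt;
  apply/negP => x0.
have := contr^~ u; move: x0.
move: (ip (r (Q u)) (r (Q u))) (ip (Q u) (Q u)) => x y x0 xy.
have cvg0 : (fun k => y * th ^+ k) @ \oo --> (0 : R).
  by apply: cvg_geometric; rewrite ger0_norm ?sqr_ge0.
suff : x <= 0 by rewrite leNgt x0.
by apply: (cvgr_to_ge cvg0); near=> k; rewrite mulrC.
Unshelve. all: by end_near. Qed.

(** Taking adjoints in [Q' Q = Q] gives [Q Q' = Q], and [Q] is a contraction. *)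
Lemma cut_norm_le Q Q' c c' : spectral_cut A Q c -> spectral_cut A Q' c' ->
  c < c' -> forall u, ip (Q u) (Q u) <= ip (Q' u) (Q' u).
Proof.
move=> hQ hQ' cc' u; have Q'Q := cut_comparison hQ hQ' cc'.
have -> : Q u = Q (Q' u).
  apply: ip_inj => w.
  by rewrite !(cp_sym (cut_cp hQ)) (cp_sym (cut_cp hQ')) Q'Q.
exact: cp_le (cut_cp hQ) _.
Qed.

End Cuts.
End InnerProduct.

(** * Square-summable families on the lattice *)

Section Summable.
Variables (R : realType) (I : choiceType).
Implicit Types f g : I -> R.

Definition absum f := summable [set: I] (EFin \o f).

Definition fsum f : R := fine (\esum_(i in [set: I]) (f i)%:E)%E.

Lemma absum_le f g : (forall i, `|f i| <= g i) ->
  (\esum_(i in [set: I]) (g i)%:E < +oo)%E -> absum f.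
Proof.
by move=> fg; apply: le_lt_trans; apply: le_esum => i _ /=; rewrite lee_fin.
Qed.

Lemma absumE f : (forall i, 0 <= f i) ->
  absum f <-> (\esum_(i in [set: I]) (f i)%:E < +oo)%E.
Proof.
move=> f0; rewrite /absum /summable.
by under eq_esum => i _ do rewrite /= ger0_norm//.
Qed.

Lemma absum_lty f : (forall i, 0 <= f i) -> absum f ->
  (\esum_(i in [set: I]) (f i)%:E < +oo)%E.
Proof. by move=> f0 /(absumE f0). Qed.

Lemma absum_fsum f : (forall i, 0 <= f i) -> absum f ->
  (\esum_(i in [set: I]) (f i)%:E)%E = (fsum f)%:E.
Proof.
move=> f0 /(absumE f0) fy; rewrite /fsum fineK// ge0_fin_numE//.
by apply: esum_ge0 => i _; rewrite lee_fin.
Qed.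

Lemma absumD f g : absum f -> absum g -> absum (fun i => f i + g i).
Proof. by move=> hf hg; have := summableD hf hg. Qed.

Lemma absumN f : absum f -> absum (fun i => - f i).
Proof. by rewrite /absum summableN. Qed.

Lemma esumZ (a : R) f : 0 <= a -> (forall i, 0 <= f i) ->
  (\esum_(i in [set: I]) (a * f i)%:E = a%:E * \esum_(i in [set: I]) (f
    i)%:E)%E.
Proof.
move=> a0 f0.
have le1 (b : R) h : 0 <= b -> (forall i, 0 <= h i) ->
    (\esum_(i in [set: I]) (b * h i)%:E <= b%:E * \esum_(i in [set: I]) (h
      i)%:E)%E.
  move=> b0 h0; apply: ge_ereal_sup => _ [X [finX _] <-].
  under eq_fsbigr do rewrite EFinM.
  rewrite -ge0_mule_fsumr; last by move=> i; rewrite lee_fin.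
  rewrite lee_wpmul2l ?lee_fin//; apply: ereal_sup_ubound; by exists X.
apply/eqP; rewrite eq_le le1//=.
move: a0; rewrite (le_eqVlt 0 a) => /predU1P[<-|a0].
  by rewrite mul0e; apply: esum_ge0 => i _; rewrite mul0r.
(* The reverse inequality is [le1] for [a^-1] and the family [a * f i]. *)
have := le1 a^-1 (fun i => a * f i); rewrite invr_ge0 ltW// => /(_ isT).
under eq_esum => i _ do rewrite mulKf ?gt_eqF//.
move=> /(_ (fun i => mulr_ge0 (ltW a0) (f0 i))).
by rewrite lee_pdivlMl.
Qed.

Lemma rsum_ge0E f : (forall i, 0 <= f i) -> rsum f = fsum f.
Proof.
move=> f0; rewrite /rsum /fsum; congr fine.
rewrite [X in (_ - X)%E]esum1 ?sube0; last first.
  by move=> i _; rewrite unlock /= max_r// lee_fin oppr_le0.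
by apply: eq_esum => i _; rewrite unlock /= max_l// lee_fin.
Qed.

(** [rsum] may be computed from any splitting into nonnegative summable families, not only from the
    positive and negative parts; additivity rests on this. *)
Lemma rsum_sub_nneg f g : (forall i, 0 <= f i) -> (forall i, 0 <= g i) ->
  absum f -> absum g -> rsum (fun i => f i - g i) = fsum f - fsum g.
Proof.
move=> f0 g0 hf hg; rewrite /rsum.
have -> : EFin \o (fun i => f i - g i) = ((EFin \o f) \- (EFin \o g))%E by [].
rewrite esumB//=; try by move=> i _; rewrite lee_fin.
by rewrite !absum_fsum.
Qed.

Lemma fsumD f g : (forall i, 0 <= f i) -> (forall i, 0 <= g i) ->
  absum f -> absum g -> fsum (fun i => f i + g i) = fsum f + fsum g.
Proof.
move=> f0 g0 hf hg; rewrite /fsum.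
under eq_esum => i _ do rewrite EFinD.
rewrite esumD; try by move=> i _; rewrite lee_fin.
by rewrite !absum_fsum.
Qed.

Let pos f i := Num.max (f i) 0.
Let neg f i := Num.max (- f i) 0.

Let pos_ge0 f i : 0 <= pos f i. Proof. by rewrite le_max lexx orbT. Qed.
Let neg_ge0 f i : 0 <= neg f i. Proof. by rewrite le_max lexx orbT. Qed.

Let posnegE f : f = (fun i => pos f i - neg f i).
Proof.
by apply/funext => i; rewrite /pos /neg; case: (leP (f i) 0) => fi;
  [rewrite max_l ?oppr_ge0// sub0r opprK|rewrite max_r ?oppr_le0 ?subr0// ltW].
Qed.

Let absum_pos f : absum f -> absum (pos f).
Proof.
move=> hf; apply: (@absum_le _ (fun i => `|f i|)) => // i;
  rewrite ger0_norm// /pos.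
by rewrite ge_max normr_ge0 ler_norm.
Qed.

Let absum_neg f : absum f -> absum (neg f).
Proof.
move=> hf; apply: (@absum_le _ (fun i => `|f i|)) => // i;
  rewrite ger0_norm// /neg.
by rewrite ge_max normr_ge0 -normrN ler_norm.
Qed.

Let rsumE f : absum f -> rsum f = fsum (pos f) - fsum (neg f).
Proof.
move=> hf; rewrite [in LHS](posnegE f).
by apply: rsum_sub_nneg => //; [exact: absum_pos|exact: absum_neg].
Qed.

Lemma rsumN f : absum f -> rsum (fun i => - f i) = - rsum f.
Proof.
move=> hf; rewrite (rsumE hf) (rsumE (absumN hf)) opprB.
by congr (fsum _ - fsum _); apply/funext => i; rewrite /pos /neg// opprK.
Qed.

Lemma rsumD f g : absum f -> absum g ->
  rsum (fun i => f i + g i) = rsum f + rsum g.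
Proof.
move=> hf hg; rewrite (rsumE hf) (rsumE hg).
have hpf := absum_pos hf; have hnf := absum_neg hf.
have hpg := absum_pos hg; have hng := absum_neg hg.
have -> : (fun i => f i + g i) =
    (fun i => (pos f i + pos g i) - (neg f i + neg g i)).
  apply/funext => i; rewrite [in LHS](posnegE f) [in LHS](posnegE g); ring.
rewrite rsum_sub_nneg; first by rewrite !fsumD//; ring.
- by move=> i; rewrite addr_ge0.
- by move=> i; rewrite addr_ge0.
- exact: absumD.
- exact: absumD.
Qed.

Lemma absumZ a f : absum f -> absum (fun i => a * f i).
Proof.
move=> hf; have nf0 i : 0 <= `|f i| by exact: normr_ge0.
apply: (@absum_le _ (fun i => `|a| * `|f i|)) => [i|]; first by rewrite normrM.
by rewrite esumZ// lte_mul_pinfty// lee_fin.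
Qed.

Lemma rsumZ a f : absum f -> rsum (fun i => a * f i) = a * rsum f.
Proof.
wlog a0 : a f / 0 <= a => [wl hf|hf].
  have [/wl|/ltW a0] := leP 0 a; first exact.
  rewrite -[a]opprK mulNr -mulrN -rsumN// -wl ?oppr_ge0//; last exact: absumN.
  by congr rsum; apply/funext => i; rewrite mulrN [LHS]mulNr.
have fsumZ g : (forall i, 0 <= g i) -> absum g ->
    fsum (fun i => a * g i) = a * fsum g.
  by move=> g0 hg; rewrite {1}/fsum esumZ// absum_fsum.
have hpf := absum_pos hf; have hnf := absum_neg hf.
rewrite [in LHS](posnegE f).
under eq_fun do rewrite mulrBr.
rewrite rsum_sub_nneg ?fsumZ//; try by move=> i; rewrite mulr_ge0.
- by rewrite (rsumE hf) mulrBr.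
- exact: absumZ.
- exact: absumZ.
Qed.

End Summable.

Lemma esum_bij (R : realType) (I : choiceType) (e : I -> I) (a : I -> \bar R) :
  bijective e ->
  (\esum_(i in [set: I]) a (e i) = \esum_(i in [set: I]) a i)%E.
Proof. by move=> be; symmetry; apply: reindex_esum;
  rewrite setTT_bijective. Qed.

Lemma rsum_bij (R : realType) (I : choiceType) (e : I -> I) (f : I -> R) :
  bijective e -> rsum (fun i => f (e i)) = rsum f.
Proof.
move=> be; rewrite /rsum -(esum_bij (EFin \o f)^\+%E be).
rewrite -(esum_bij (EFin \o f)^\-%E be).
by congr (fine (_ - _)%E); apply: eq_esum => i _; rewrite !unlock.
Qed.

Section Dot.
Variable R : realType.
Implicit Types z w : R[i].

Definition sq z : R := complex.Re z ^+ 2 + complex.Im z ^+ 2.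

Definition dot z w : R :=
  complex.Re z * complex.Re w + complex.Im z * complex.Im w.

Lemma sq_ge0 z : 0 <= sq z.
Proof. by rewrite addr_ge0// sqr_ge0. Qed.

Lemma sq_eq0 z : sq z = 0 -> z = 0.
Proof.
case: z => a b; rewrite /sq /= => /eqP.
by rewrite paddr_eq0 ?sqr_ge0// !sqrf_eq0 => /andP[/eqP-> /eqP->].
Qed.

Lemma sq0 : sq 0 = 0.
Proof. by rewrite /sq /= expr0n addr0. Qed.

Lemma sqM z w : sq (z * w) = sq z * sq w.
Proof. case: z => a b; case: w => c e; rewrite /sq /=; ring. Qed.

Lemma sqD_le z w : sq (z + w) <= 2 * (sq z + sq w).
Proof.
case: z => a b; case: w => c e; rewrite /sq /= -subr_ge0.
have -> : 2 * (a ^+ 2 + b ^+ 2 + (c ^+ 2 + e ^+ 2)) -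
    ((a + c) ^+ 2 + (b + e) ^+ 2) = (a - c) ^+ 2 + (b - e) ^+ 2 by ring.
by rewrite addr_ge0// sqr_ge0.
Qed.

Lemma sq_conjM z : z^* * z = (sq z)%:C.
Proof. by case: z => a b; rewrite /sq; simpc; congr (_ +i* _); ring. Qed.

Lemma dotE z w : complex.Re (z^* * w) = dot z w.
Proof. by case: z => a b; case: w => c e; rewrite /dot /= mulNr opprK. Qed.

Lemma dotzz z : dot z z = sq z.
Proof. by rewrite /dot -!expr2. Qed.

Lemma dot_le z w : `|dot z w| <= sq z + sq w.
Proof.
case: z => a b; case: w => c e; rewrite /dot /sq /=.
rewrite ler_norml; apply/andP; split.
  have := sqr_ge0 (a + c); have := sqr_ge0 (b + e).
  have := sqr_ge0 a; have := sqr_ge0 b; have := sqr_ge0 c; have := sqr_ge0 e.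
  rewrite !sqrrD; lra.
have := sqr_ge0 (a - c); have := sqr_ge0 (b - e).
have := sqr_ge0 a; have := sqr_ge0 b; have := sqr_ge0 c; have := sqr_ge0 e.
rewrite !sqrrB; lra.
Qed.

End Dot.

Section Ell2Space.
Variables (R : realType) (d : nat).

Notation F := (site d -> R[i]).
Implicit Types u v : F.

Lemma ell2E u : ell2 u <-> absum (fun n => sq (u n)).
Proof. by rewrite absumE// => i; exact: sq_ge0. Qed.

Lemma ell2D u v : ell2 u -> ell2 v -> ell2 (fun n => u n + v n).
Proof.
move=> /ell2E hu /ell2E hv; apply/ell2E.
apply: (@absum_le _ _ _ (fun n => 2 * (sq (u n) + sq (v n)))) => [n|].
  by rewrite ger0_norm ?sq_ge0 ?sqD_le.
apply: absum_lty; first by move=> n; rewrite mulr_ge0// addr_ge0// sq_ge0.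
exact/absumZ/absumD.
Qed.

Lemma ell2Z (a : R[i]) u : ell2 u -> ell2 (fun n => a * u n).
Proof.
move=> /ell2E hu; apply/ell2E; under eq_fun do rewrite sqM.
exact: absumZ.
Qed.

Lemma ell2_0 : ell2 ((fun=> 0) : F).
Proof. by rewrite /ell2 /sqnorm esum1 ?ltry// => n _;
  rewrite /= expr0n addr0. Qed.

Lemma ell2N u : ell2 u -> ell2 (fun n => - u n).
Proof.
by move=> hu; under eq_fun do rewrite -mulN1r; exact: ell2Z.
Qed.

Lemma dot_absum u v : ell2 u -> ell2 v -> absum (fun n => dot (u n) (v n)).
Proof.
move=> /ell2E hu /ell2E hv.
apply: (@absum_le _ _ _ (fun n => sq (u n) + sq (v n))) => [n|].
  exact: dot_le.
apply: absum_lty; first by move=> n; rewrite addr_ge0// sq_ge0.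
exact: absumD.
Qed.

Lemma Re_innerE u v : complex.Re (inner u v) = rsum (fun n => dot (u n) (v n)).
Proof. by congr rsum; apply/funext => n; rewrite dotE. Qed.

Record l2 := L2 { l2fun :> F ; l2P : ell2 l2fun }.

Lemma l2_inj (u v : l2) : (forall n, u n = v n) -> u = v.
Proof.
case: u v => [u hu] [v hv] /= /funext uv.
by subst v; congr L2; exact: Prop_irrelevance.
Qed.

End Ell2Space.

HB.instance Definition _ R d := gen_eqMixin (l2 R d).
HB.instance Definition _ R d := gen_choiceMixin (l2 R d).

Section Ell2Lmodule.
Variables (R : realType) (d : nat).
Notation V := (l2 R d).

Definition l2_zero : V := L2 (@ell2_0 R d).
Definition l2_opp (u : V) : V := L2 (ell2N (l2P u)).
Definition l2_add (u v : V) : V := L2 (ell2D (l2P u) (l2P v)).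
Definition l2_scale (a : R) (u : V) : V := L2 (ell2Z a%:C (l2P u)).

Lemma l2_addA : associative l2_add.
Proof. by move=> u v w; apply: l2_inj => n; rewrite /= addrA. Qed.
Lemma l2_addC : commutative l2_add.
Proof. by move=> u v; apply: l2_inj => n; rewrite /= addrC. Qed.
Lemma l2_add0 : left_id l2_zero l2_add.
Proof. by move=> u; apply: l2_inj => n; rewrite /= add0r. Qed.
Lemma l2_addN : left_inverse l2_zero l2_opp l2_add.
Proof. by move=> u; apply: l2_inj => n; rewrite /= addNr. Qed.

HB.instance Definition _ := GRing.isZmodule.Build V
  l2_addA l2_addC l2_add0 l2_addN.

Lemma l2_scaleA a b u : l2_scale a (l2_scale b u) = l2_scale (a * b) u.
Proof. by apply: l2_inj => n; rewrite /= rmorphM mulrA. Qed.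
Lemma l2_scale1 : left_id 1 l2_scale.
Proof. by move=> u; apply: l2_inj => n; rewrite /= mul1r. Qed.
Lemma l2_scaleDr : right_distributive l2_scale +%R.
Proof. by move=> a u v; apply: l2_inj => n; rewrite /= mulrDr. Qed.
Lemma l2_scaleDl u : {morph l2_scale^~ u : a b / a + b}.
Proof. by move=> a b; apply: l2_inj => n; rewrite /= rmorphD mulrDl. Qed.

HB.instance Definition _ := GRing.Zmodule_isLmodule.Build R V
  l2_scaleA l2_scale1 l2_scaleDr l2_scaleDl.

Lemma l2_subE (u v : V) n : (u - v) n = u n - v n. Proof. by []. Qed.
Lemma l2_scaleE a (u : V) n : (a *: u) n = a%:C * u n. Proof. by []. Qed.
Lemma l2_zeroE n : (0 : V) n = 0. Proof. by []. Qed.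

(** The real part of [inner]. Forgetting the complex structure keeps the norm and makes [l2] a real
    inner product space, the setting of the results on spectral cuts. *)
Definition ip (u v : V) : R := rsum (fun n => dot (u n) (v n)).

Lemma ip_form : psd_form ip.
Proof.
split=> [u v|u v w|a u v|u].
- by congr rsum; apply/funext => n; rewrite /dot mulrC [X in _ + X]mulrC.
- rewrite -rsumD; try by apply: dot_absum; exact: l2P.
  by congr rsum; apply/funext => n; rewrite /dot !raddfD/= !mulrDr addrACA.
- rewrite -rsumZ; last by apply: dot_absum; exact: l2P.
  congr rsum; apply/funext => n; rewrite /dot l2_scaleE.
  by case: (u n) => x y; case: (v n) => z t /=; ring.
- rewrite /ip rsum_ge0E; last by move=> n; rewrite dotzz sq_ge0.
  by rewrite fine_ge0// esum_ge0// => n _; rewrite lee_fin dotzz sq_ge0.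
Qed.

Lemma ipuuE (u : V) : ((ip u u)%:E = sqnorm u)%E.
Proof.
rewrite /ip rsum_ge0E; last by move=> n; rewrite dotzz sq_ge0.
rewrite -absum_fsum; first by apply: eq_esum => n _; rewrite dotzz.
- by move=> n; rewrite dotzz sq_ge0.
- by apply: dot_absum; exact: l2P.
Qed.

Lemma ip_eq0 (u : V) : ip u u = 0 -> u = 0.
Proof.
move=> u0; apply: l2_inj => n /=; apply: sq_eq0; apply/eqP.
rewrite eq_le sq_ge0 andbT -lee_fin -[leRHS]/(0%:E) -u0 ipuuE.
apply: esum_ge; exists [set n]; first by split => //; exact: finite_set1.
by rewrite fsbig_set1.
Qed.

End Ell2Lmodule.

(** * The lattice Laplacian *)

Section Lattice.
Variables (R : realType) (d : nat).
Implicit Types (n k : site d) (nu : site_norm).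

Definition unit_site (i : 'I_d) : site d := [ffun j => (j == i)%:R].

Definition signed_unit (p : 'I_d * bool) : site d :=
  if p.2 then unit_site p.1 else - unit_site p.1.

Lemma signed_unitE p i :
  signed_unit p i = if i == p.1 then (if p.2 then 1 else -1) else 0.
Proof. by case: p => j [] /=; rewrite !ffunE; case: eqP. Qed.

Lemma signed_unit_inj : injective signed_unit.
Proof.
move=> p q /ffunP pq; have := pq q.1; have := pq p.1.
rewrite !signed_unitE !eqxx; case: p q {pq} => i a [j b] /=.
have [<-|ij] := eqVneq i j; first by case: a b => -[].
by case: a.
Qed.

Lemma snorm_signed_unit nu p : snorm R nu (signed_unit p) = 1.
Proof.
have off i : i != p.1 -> signed_unit p i = 0.
  by move=> ip; rewrite signed_unitE (negbTE ip).
case: nu; rewrite /snorm (bigD1 p.1)//= signed_unitE eqxx big1 ?addr0.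
- by case: p.2; rewrite ?rmorphN rmorph1 ?sqrrN expr1n sqrtr1.
- by move=> i /off->; rewrite mulr0z expr0n.
- by case: p.2; rewrite ?rmorphN rmorph1 ?normrN normr1.
- by move=> i /off->; rewrite mulr0z normr0.
Qed.

(** For either norm a sum of natural numbers, squares or absolute values of the coordinates, equals
    1; so exactly one coordinate is nonzero, and it is a sign. *)
Lemma snorm_eq1 nu n : snorm R nu n = 1 -> exists p, n = signed_unit p.
Proof.
have absE (z : int) : `|z%:~R : R| = (`|z|%N)%:R.
  by rewrite -intr_norm -abszE.
have fin (f : int -> nat) : f 0 = 0%N -> (forall z, f z = 0%N -> z = 0) ->
    (forall z, f z = 1%N -> `|z|%N = 1%N) ->
    (\sum_(i < d) f (n i))%N == 1%N -> exists p, n = signed_unit p.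
  move=> f0 f0' f1 /sum_nat_eq1[i [_ /f1 fi /(_ _ _ isT) fj]].
  exists (i, 0 <= n i); apply/ffunP => j; rewrite signed_unitE /=.
  have [->|/fj/f0'//] := eqVneq j i.
  by move: fi; case: (n i) => m /= => [-> //|[->]].
case: nu; rewrite /snorm.
  move=> /(congr1 (fun x => x ^+ 2)); rewrite expr1n sqr_sqrtr; last first.
    by apply: sumr_ge0 => i _; exact: sqr_ge0.
  under eq_bigr do rewrite -real_normK ?num_real// absE -natrX.
  rewrite -natr_sum => /eqP; rewrite pnatr_eq1.
  apply: (fin (fun z => `|z| ^ 2)%N) => // z.
    by move/eqP; rewrite expn_eq0 /= andbT absz_eq0 => /eqP.
  by move=> /eqP; rewrite -[1%N](exp1n 2) eqn_exp2r// => /eqP.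
under eq_bigr do rewrite absE.
rewrite -natr_sum => /eqP; rewrite pnatr_eq1.
by apply: (fin absz) => // z /eqP; rewrite absz_eq0 => /eqP.
Qed.

(** Listing the neighbours explicitly removes the norm from the Laplacian. *)
Lemma laplacianE nu (u : site d -> R[i]) n : laplacian nu u n =
  \sum_(i < d) (u (n + unit_site i) + u (n - unit_site i)).
Proof.
pose r := [seq n + signed_unit p | p : 'I_d * bool].
have ur : uniq r.
  rewrite map_inj_uniq; first exact: enum_uniq.
  by move=> p q /addrI/signed_unit_inj.
have -> : laplacian nu u n = \sum_(k <- r) u k.
  rewrite fsbig_seq//; apply: eq_fsbigl; apply/seteqP; split => k /=.
    move=> /snorm_eq1[p kp]; apply/mapP; exists p; first by rewrite mem_enum.
    by rewrite -kp addrC subrK.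
  by move=> /mapP[p _ ->]; rewrite addrAC subrr add0r snorm_signed_unit.
rewrite big_map big_enum /=.
rewrite (eq_bigr (fun p => u (n + signed_unit (p.1, p.2)))); last by case.
rewrite -(pair_bigA _ (fun i b => u (n + signed_unit (i, b)))) /=.
by apply: eq_bigr => i _; rewrite big_bool.
Qed.

End Lattice.

Section Shift.
Variables (R : realType) (d : nat).
Notation V := (l2 R d).

Lemma bij_addr (a : site d) : bijective (fun n => n + a).
Proof. by exists (fun n => n - a) => n; rewrite ?addrK ?subrK. Qed.

Lemma ell2_shift (a : site d) (u : V) : ell2 (fun n => u (n + a)).
Proof.
rewrite /ell2 /sqnorm.
by rewrite (esum_bij (fun n => (complex.Re (u n) ^+ 2 + complex.Im (u n) ^+
  2)%:E)%E
  (bij_addr a)); exact: l2P.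
Qed.

Definition shift (a : site d) (u : V) : V := L2 (ell2_shift a u).

Lemma shift_is_linear a : linear (shift a).
Proof. by move=> x u v; exact: l2_inj. Qed.

HB.instance Definition _ a :=
  GRing.isLinear.Build R V V *:%R (shift a) (shift_is_linear a).

Lemma shiftK a : cancel (shift a) (shift (- a)).
Proof. by move=> u; apply: l2_inj => n /=; rewrite subrK. Qed.

Lemma shiftNK a : cancel (shift (- a)) (shift a).
Proof. by move=> u; apply: l2_inj => n /=; rewrite addrK. Qed.

Lemma shift_shift a b u : shift a (shift b u) = shift (a + b) u.
Proof. by apply: l2_inj => n /=; rewrite addrA. Qed.

Lemma ip_shift a u v : ip (shift a u) (shift a v) = ip u v.
Proof. exact: (rsum_bij (fun n => dot (u n) (v n)) (bij_addr a)). Qed.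

Lemma ip_shiftl a u v : ip (shift a u) v = ip u (shift (- a) v).
Proof. by rewrite -{1}(shiftNK a v) ip_shift. Qed.

Definition hop (i : 'I_d) (u : V) : V :=
  shift (unit_site i) u + shift (- unit_site i) u.

Definition lap (u : V) : V := \sum_(i < d) hop i u.

Lemma hop_is_linear i : linear (hop i).
Proof. by move=> x u v; rewrite /hop !linearP scalerDr addrACA. Qed.

HB.instance Definition _ i :=
  GRing.isLinear.Build R V V *:%R (hop i) (hop_is_linear i).

Lemma lap_is_linear : linear lap.
Proof.
move=> x u v; rewrite /lap scaler_sumr -big_split; apply: eq_bigr => i _ /=.
by rewrite linearP.
Qed.

HB.instance Definition _ := GRing.isLinear.Build R V V *:%R lap lap_is_linear.

Lemma l2_sumE (I : Type) (r : seq I) (P : pred I) (f : I -> V) n :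
  (\sum_(i <- r | P i) f i) n = \sum_(i <- r | P i) f i n.
Proof. by elim/big_rec2: _ => // i y1 y2 _ <-. Qed.

Lemma lapE nu (u : V) : lap u = laplacian nu u :> (site d -> R[i]).
Proof. by apply/funext => n; rewrite laplacianE /lap l2_sumE. Qed.

Lemma hop_sym i u v : ip (hop i u) v = ip u (hop i v).
Proof.
rewrite /hop (formDl (@ip_form R d)) (form_add (@ip_form R d)) !ip_shiftl.
by rewrite opprK addrC.
Qed.

Lemma ip_sumr (I : Type) (r : seq I) (P : pred I) (f : I -> V) u :
  ip u (\sum_(i <- r | P i) f i) = \sum_(i <- r | P i) ip u (f i).
Proof.
elim/big_rec2: _ => [|i y1 y2 _ <-]; first exact: form_0r (@ip_form R d) _.
by rewrite (form_add (@ip_form R d)).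
Qed.

Lemma ip_suml (I : Type) (r : seq I) (P : pred I) (f : I -> V) u :
  ip (\sum_(i <- r | P i) f i) u = \sum_(i <- r | P i) ip (f i) u.
Proof.
rewrite (form_sym (@ip_form R d)) ip_sumr; apply: eq_bigr => i _.
exact: form_sym (@ip_form R d) _ _.
Qed.

Lemma lap_sym u v : ip (lap u) v = ip u (lap v).
Proof.
by rewrite /lap ip_suml ip_sumr; apply: eq_bigr => i _; rewrite hop_sym.
Qed.

Lemma hop_shift i a u : hop i (shift a u) = shift a (hop i u).
Proof. by rewrite /hop linearD/= !shift_shift ![a + _]addrC. Qed.

Lemma lap_shift a u : lap (shift a u) = shift a (lap u).
Proof. by rewrite /lap linear_sum; apply: eq_bigr => i _;
  rewrite hop_shift. Qed.

End Shift.

(** * Absence of square-summable eigenfunctions *)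

(** Serves for arbitrarily many equal terms whose total stays bounded. *)
Lemma le0_of_mulrn_le (R : archiFieldType) (x C : R) :
  (forall K : nat, x *+ K <= C) -> x <= 0.
Proof.
move=> h; rewrite leNgt; apply/negP => x0.
have C0 : 0 <= C by have := h 0%N; rewrite mulr0n.
have := h (Num.truncn (C / x)).+1; rewrite leNgt => /negP; apply.
by rewrite -mulr_natl -ltr_pdivrMr// truncnS_gt.
Qed.

Lemma unit_siteMz (d : nat) (i : 'I_d) (a : int) (j : 'I_d) :
  (unit_site i *~ a) j = if j == i then a else 0.
Proof.
by case: a => m; rewrite ?NegzE ?mulrNz -pmulrn !(ffunE, ffunMnE);
  case: eqP => _; rewrite ?mul0rn ?natz// oppr0.
Qed.

Section NoEigenfunction.
Variables (R : realType) (d : nat) (i0 : 'I_d).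
Notation V := (l2 R d).
Notation e := (unit_site i0).
Let hip := @ip_form R d.

Lemma ell2_layer (b : int) (u : V) : ell2 (fun n =>
  if n i0 == b then u n else 0).
Proof.
apply/ell2E; apply: (@absum_le _ _ _ (fun n => sq (u n))) => [n|].
  by rewrite ger0_norm ?sq_ge0//; case: ifP => //; rewrite sq0 sq_ge0.
exact: (l2P u).
Qed.

(** The slice stays a function on the whole lattice, extended by 0, so that the hops in the other
    directions still act on it. *)
Definition layer b (u : V) : V := L2 (ell2_layer b u).

Lemma layer_is_linear b : linear (layer b).
Proof.
by move=> x u v; apply: l2_inj => n /=; case: ifP => //; rewrite mulr0 addr0.
Qed.

HB.instance Definition _ b :=
  GRing.isLinear.Build R V V *:%R (layer b) (layer_is_linear b).

Lemma hop_layer i b u : i != i0 -> hop i (layer b u) = layer b (hop i u).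
Proof.
move=> ii0; apply: l2_inj => n /=.
rewrite !ffunE (eq_sym i0) (negbTE ii0) !addr0.
by case: ifP => //; rewrite addr0.
Qed.

(** Distinct layers have disjoint supports. *)
Lemma sum_ip_layer (u : V) b (K : nat) :
  \sum_(k < K) ip (layer (b + k%:Z) u) (layer (b + k%:Z) u) <= ip u u.
Proof.
rewrite -lee_fin -sumEFin ipuuE.
under eq_bigr do rewrite ipuuE.
rewrite -esum_sum; last by move=> n k _ _; rewrite lee_fin addr_ge0// sqr_ge0.
apply: le_esum => n _; rewrite sumEFin lee_fin.
have [[k nk]|nk] := pselect (exists k : 'I_K, n i0 = b + k%:Z).
  rewrite (bigD1 k)//= nk eqxx big1 ?addr0// => j jk.
  rewrite (inj_eq (addrI b)) eqz_nat val_eqE eq_sym (negbTE jk).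
  by rewrite /= expr0n addr0.
rewrite big1 ?addr_ge0 ?sqr_ge0// => k _ /=; case: ifPn => [/eqP nbk|_].
  by case: nk; exists k.
by rewrite /= expr0n addr0.
Qed.

Section Eigenfunction.
Variables (E : R) (u : V).
Hypothesis hu : lap u = E *: u.

(** Every slice is moved to layer [0], so that [phi] can pair different slices. *)
Let w (a : int) : V := layer 0 (shift (e *~ a) u).
Let phi a b := ip (w a) (w b).

Let norm_w a : phi a a = ip (layer a u) (layer a u).
Proof.
rewrite -[RHS](ip_shift (e *~ a)).
suff -> : shift (e *~ a) (layer a u) = w a by [].
apply: l2_inj => n /=.
by rewrite ffunE unit_siteMz eqxx -[X in _ == X]add0r (inj_eq (addIr a)).
Qed.

(** The eigenvalue equation slice by slice: hops along [i0] join neighbouring slices, the others act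
    inside one slice. *)
Let w_step a : w (a + 1) + w (a - 1) =
  E *: w a - \sum_(i < d | i != i0) hop i (w a).
Proof.
have -> : \sum_(i < d | i != i0) hop i (w a) =
    layer 0 (shift (e *~ a) (\sum_(i < d | i != i0) hop i u)).
  rewrite !linear_sum; apply: eq_bigr => i ii0.
  by rewrite hop_layer// hop_shift.
rewrite /w -!linearD -!linearZ -!linearB; congr (layer 0 _).
rewrite -hu /lap (bigD1 i0)//= addrK /hop linearD/= !shift_shift.
by rewrite !mulrzDr mulrNz.
Qed.

(** By [w_step] both sides equal [E * phi a b] minus the form of the hops inside a slice, which are
    symmetric. *)
Let wave a b : phi (a + 1) b + phi (a - 1) b = phi a (b + 1) + phi a (b - 1).
Proof.
rewrite /phi -(formDl hip) -(form_add hip) !w_step (formBl hip) (formBr hip).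
rewrite (formZl hip) (form_scale hip) ip_suml ip_sumr.
by congr (_ - _); apply: eq_bigr => i _; rewrite hop_sym.
Qed.

(* A solution of the discrete wave equation vanishing at infinity has no
   component travelling along the antidiagonals. *)
Let diagonal a b : phi (a + 1) b = phi a (b - 1).
Proof.
pose psi a b := phi (a + 1) b - phi a (b - 1).
have step x y : psi x y = psi (x - 1) (y + 1).
  by rewrite /psi subrK addrK; have := wave x y; lra.
have far k : psi a b = psi (a - k%:Z) (b + k%:Z).
  elim: k => [|k ->]; first by rewrite subr0 addr0.
  by rewrite step -addn1 PoszD opprD !addrA.
have phi_le x y : phi x y ^+ 2 <= ip u u * phi y y.
  apply: le_trans (form_CauchySchwarz hip _ _) _.
  rewrite ler_wpM2r ?(form_ge0 hip)// -[ip (w x) _]/(phi x x) norm_w.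
  by have := sum_ip_layer u x 1; rewrite big_ord1 addr0.
suff : psi a b ^+ 2 <= 0.
  by rewrite real_exprn_even_le0 ?num_real//= subr_eq0 => /eqP.
(* At each of [K] points of the antidiagonal [phi_le] bounds the square of [psi a b]; by
   [sum_ip_layer] these bounds have a total independent of [K]. *)
apply: (@le0_of_mulrn_le _ _ (2 * (ip u u * ip u u + ip u u * ip u u))) => K.
rewrite -[K in _ *+ K]card_ord -sumr_const.
apply: (@le_trans _ _ (\sum_(k < K) 2 *
    (ip u u * phi (b + k%:Z) (b + k%:Z) +
     ip u u * phi (b - 1 + k%:Z) (b - 1 + k%:Z)))).
  apply: ler_sum => k _; rewrite (far k) /psi.
  have := phi_le (a - k%:Z + 1) (b + k%:Z).
  have := phi_le (a - k%:Z) (b - 1 + k%:Z).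
  rewrite [b - 1 + _]addrAC; set x := phi _ (b + k%:Z).
  set y := phi (a - _) _; have := sqr_ge0 (x + y); rewrite sqrrB sqrrD; lra.
rewrite -mulr_sumr ler_wpM2l// big_split /= -!mulr_sumr.
by rewrite lerD// ler_wpM2l ?(form_ge0 hip)//;
  under eq_bigr do rewrite norm_w; exact: sum_ip_layer.
Qed.

(** By [diagonal] with [b = a + 1] all slices have the same norm, and their squared norms have a
    bounded sum. *)
Lemma lap_no_eigenfunction : u = 0.
Proof.
have const a (k : nat) : phi a a = phi (a + k%:Z) (a + k%:Z).
  elim: k => [|k ->]; first by rewrite addr0.
  by rewrite -addn1 PoszD addrA diagonal addrK.
have phi0 a : phi a a = 0.
  apply/eqP; rewrite eq_le (form_ge0 hip) andbT.
  apply: (@le0_of_mulrn_le _ _ (ip u u)) => K.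
  rewrite -[K in _ *+ K]card_ord -sumr_const.
  under eq_bigr => k _ do rewrite (const a k) norm_w.
  exact: sum_ip_layer.
apply: l2_inj => n; have := phi0 (n i0).
by rewrite norm_w => /ip_eq0/(congr1 (fun v : V => v n)) /=; rewrite eqxx.
Qed.

End Eigenfunction.

End NoEigenfunction.

(** * The spectral measure of the Laplacian *)

Section RealMeasure.
Import HBNNSimple.
Variable R : realType.

(** Stated for bare set functions, since [pvm_integral] integrates against one; simple functions
    evaluate them on measurable sets only. *)
Lemma eq_integral_measurable (m1 m2 : set R -> \bar R) (f : R -> \bar R) :
  (forall B, measurable B -> m1 B = m2 B) ->
  (\int[m1]_x f x = \int[m2]_x f x)%E.
Proof.
move=> m12; rewrite /integral.
suff sint (h : {nnsfun R >-> R}) : sintegral m1 h = sintegral m2 h.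
  by congr (ereal_sup _ - ereal_sup _)%E; apply: eq_imagel => h _; exact: sint.
by apply: eq_fsbigr => x _; rewrite m12.
Qed.

Lemma integral_id_between (m : {finite_measure set R -> \bar R}) (B : set R)
    (a b : R) : measurable B -> B `<=` `[a, b]%classic -> m (~` B) = 0%E ->
  (a%:E * m setT <= \int[m]_x x%:E <= b%:E * m setT)%E.
Proof.
move=> mB Bab mCB0.
(* If [b < a], then [B] is empty and [m] is zero. *)
have [ab|ba] := leP a b; last first.
  have B0 : B = set0.
    apply/seteqP; split => x // /Bab; rewrite /= in_itv/= => /andP[ax xb].
    by have := lt_le_trans ba (le_trans ax xb); rewrite ltxx.
  have m0 : m setT = 0%E by rewrite -mCB0 B0 setC0.
  rewrite m0 !mule0 (ae_eq_integral (cst 0)%E)//.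
    by rewrite integral0 lexx.
  by exists setT; split.
(* The identity clamped to [[a, b]]: bounded, hence integrable for a finite measure, and equal to
   the identity on [B]. *)
pose g (x : R) := Num.max a (Num.min b x).
have mg : measurable_fun setT g.
  by apply: measurable_maxr => //; exact: measurable_minr.
have ag x : a <= g x by rewrite le_max lexx.
have gb x : g x <= b by rewrite ge_max ab ge_min lexx.
have mEg : measurable_fun setT (EFin \o g) by exact/measurable_EFinP.
rewrite (ae_eq_integral (EFin \o g))//; last first.
  exists (~` B); split => //; first exact: measurableC.
  move=> x /= nx Bx; apply: nx => _; congr EFin.
  have := Bab _ Bx; rewrite /= in_itv/= => /andP[ax xb].
  by rewrite /g min_r// max_r.
have intc (c : R) : m.-integrable setT (EFin \o cst c).
  exact: finite_measure_integrable_cst.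
have ig : m.-integrable setT (EFin \o g).
  apply: (le_integrable measurableT mEg _ (intc (`|a| + `|b|))) => x _ /=.
  rewrite lee_fin [leRHS]ger0_norm ?addr_ge0// ler_norml; apply/andP; split.
    rewrite (le_trans _ (ag x))// lerNl (le_trans (ler_norm _))// normrN.
    by rewrite lerDl.
  by rewrite (le_trans (gb x))// (le_trans (ler_norm _))// lerDr.
rewrite -!integral_cst//; apply/andP; split.
  by apply: le_integral => //; [exact: intc|move=> x _; rewrite lee_fin].
by apply: le_integral => //; [exact: intc|move=> x _; rewrite lee_fin].
Qed.

End RealMeasure.

Section SpectralMeasure.
Variables (R : realType) (d : nat) (nu : site_norm).
Variable PE : set R -> (site d -> R[i]) -> site d -> R[i].
Hypothesis hPE : is_spectral_measure (laplacian nu) PE.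
Notation V := (l2 R d).
Let hip := @ip_form R d.

(* Set to 0 on non-measurable sets, where [is_spectral_measure] says nothing, so
   that [smeasure] below is nonnegative on all sets. *)
Definition pe (B : set R) (u : V) : V :=
  if pselect (measurable B) is left mB
  then let: And4 pl2 _ _ _ := pvm_proj hPE mB in L2 (pl2 _ (l2P u)) else 0.

Lemma peE B u : measurable B -> pe B u = PE B u :> (site d -> R[i]).
Proof.
by move=> mB; rewrite /pe; case: pselect => // mB'; case: (pvm_proj hPE mB').
Qed.

Lemma ip_innerE (u v : V) : ip u v = complex.Re (inner u v).
Proof. by rewrite Re_innerE. Qed.

Lemma l2_eqfun (u v : V) : u = v :> (site d -> R[i]) -> u = v.
Proof. by move=> uv; apply: l2_inj => n; rewrite uv. Qed.

Lemma pe_clinear B (a : R[i]) (u v w : V) : measurable B ->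
  w = (fun n => a * u n + v n) :> (site d -> R[i]) ->
  forall n, pe B w n = a * pe B u n + pe B v n.
Proof.
move=> mB wE n; rewrite !peE// wE; case: (pvm_proj hPE mB) => _ lin _ _.
by rewrite lin//; exact: l2P.
Qed.

Lemma pe_idem B u : pe B (pe B u) = pe B u.
Proof.
have [mB|nmB] := pselect (measurable B); last by rewrite /pe; case: pselect.
apply: l2_eqfun; rewrite !peE//; case: (pvm_proj hPE mB) => _ _ idem _.
by rewrite idem//; exact: l2P.
Qed.

Lemma pe_sym B u v : ip (pe B u) v = ip u (pe B v).
Proof.
have [mB|nmB] := pselect (measurable B); last first.
  rewrite /pe; case: pselect => // _.
  by rewrite (form_0r hip) (form_sym hip) (form_0r hip).
rewrite !ip_innerE !peE//; case: (pvm_proj hPE mB) => _ _ _ sym.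
by rewrite sym//; exact: l2P.
Qed.

Lemma pe_set0 u : pe set0 u = 0.
Proof.
by apply: l2_eqfun; rewrite peE// (pvm_set0 hPE)//; exact: l2P.
Qed.

Lemma pe_setT u : pe setT u = u.
Proof.
by apply: l2_eqfun; rewrite peE// (pvm_setT hPE)//; exact: l2P.
Qed.

Lemma pe_setI B C u : measurable B -> measurable C ->
  pe (B `&` C) u = pe B (pe C u).
Proof.
move=> mB mC; apply: l2_eqfun; rewrite !peE//; last exact: measurableI.
by rewrite (pvm_setI hPE)//; exact: l2P.
Qed.

Section Measure.
Variable u : V.

Definition smeasure (B : set R) : \bar R := (ip u (pe B u))%:E.

Lemma smeasureE B : smeasure B = (ip (pe B u) (pe B u))%:E.
Proof. by rewrite pe_sym pe_idem. Qed.

Let smeasure0 : smeasure set0 = 0%E.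
Proof. by rewrite /smeasure pe_set0 (form_0r hip). Qed.

Let smeasure_ge0 B : (0 <= smeasure B)%E.
Proof. by rewrite smeasureE lee_fin (form_ge0 hip). Qed.

(** Strong additivity makes the remainders [r m] small in norm, and Cauchy-Schwarz makes their
    products with [u] small. *)
Let smeasure_sigma : semi_sigma_additive smeasure.
Proof.
move=> F mF tF mUF.
pose r m : V := pe (\bigcup_k F k) u - \sum_(k < m) pe (F k) u.
have r0 : (fun m => ip (r m) (r m)) @ \oo --> (0 : R).
  have /fine_cvg := pvm_bigcup hPE mF tF (l2P u).
  apply: cvg_trans; apply: near_eq_cvg; near=> m.
  rewrite /= -[RHS]/(fine (ip (r m) (r m))%:E) ipuuE; congr (fine (sqnorm _)).
  apply/funext => n; rewrite /r l2_subE l2_sumE peE;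
    last exact: bigcupT_measurable.
  congr (_ - _).
  by apply: eq_bigr => k _; rewrite peE.
have ur0 : (fun m => ip u (r m)) @ \oo --> (0 : R).
  apply/cvgr0Pnorm_lt => e e0.
  (* The [+ 1] keeps the denominator positive when [u = 0]. *)
  have c0 : 0 < e ^+ 2 / (ip u u + 1).
    by rewrite divr_gt0 ?exprn_gt0// ltr_wpDl// (form_ge0 hip).
  move/cvgr0Pnorm_lt : r0 => /(_ _ c0); apply: filterS => m.
  rewrite ger0_norm ?(form_ge0 hip)// => rm.
  rewrite -(ltr_pXn2r (n := 2))// ?nnegrE ?normr_ge0 ?(ltW e0)//.
  rewrite real_normK ?num_real//.
  apply: le_lt_trans (form_CauchySchwarz hip _ _) _.
  have uu1 : 0 < ip u u + 1 by rewrite ltr_wpDl// (form_ge0 hip).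
  move: rm; rewrite ltr_pdivlMr// => /(le_lt_trans _); apply.
  by rewrite mulrC ler_wpM2l ?(form_ge0 hip)// lerDl.
rewrite /smeasure.
have -> : (fun n => (\sum_(0 <= k < n) (ip u (pe (F k) u))%:E)%E) =
    EFin \o (fun m => ip u (pe (\bigcup_k F k) u) - ip u (r m)).
  apply/funext => m /=; rewrite /r (formBr hip) ip_sumr opprB addrC subrK.
  by rewrite big_mkord sumEFin.
apply: cvg_EFin; first by near=> m.
rewrite -[X in _ --> X]subr0; apply: cvgB => //; exact: cvg_cst.
Unshelve. all: by end_near. Qed.

HB.instance Definition _ := isMeasure.Build _ _ R smeasure
  smeasure0 smeasure_ge0 smeasure_sigma.

Let smeasure_fin : fin_num_fun smeasure.
Proof. by []. Qed.

HB.instance Definition _ := Measure_isFinite.Build _ _ R smeasure smeasure_fin.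

End Measure.

Lemma ip_lapE u : ip u (lap u) = fine (\int[smeasure u]_x x%:E)%E.
Proof.
rewrite ip_innerE (lapE nu) (pvm_integral hPE (l2P u)) /=.
congr fine; apply: eq_integral_measurable => B mB.
by rewrite /smeasure ip_innerE peE.
Qed.

Lemma form_between B (a b : R) u : measurable B -> B `<=` `[a, b]%classic ->
  pe (~` B) u = 0 -> a * ip u u <= ip u (lap u) <= b * ip u u.
Proof.
move=> mB Bab nB; rewrite ip_lapE.
have nB0 : smeasure u (~` B) = 0%E by rewrite /smeasure nB (form_0r hip).
have sT : smeasure u setT = (ip u u)%:E by rewrite /smeasure pe_setT.
have : (a%:E * smeasure u setT <= \int[smeasure u]_x x%:E <=
    b%:E * smeasure u setT)%E by exact: integral_id_between nB0.
(* [fine] would send an infinite integral to 0; the two finite bounds exclude infinite values. *)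
rewrite sT; case: (integral _ _ _) => [x| |] //=; rewrite -?EFinM ?lee_fin//.
by move=> /andP[_]; rewrite leye_eq.
Qed.

(** Commuting with the identity is automatic; this instance supplies the additivity of [pe B] before
    [pe_lap] is known. *)
Lemma pe_cp_id B : commuting_projection (@ip R d) idfun (pe B).
Proof. by split=> // [u|u v]; [exact: pe_idem|exact: pe_sym]. Qed.

(** If [x] is in the range of [pe B] and [y] in its kernel, then [x + y] and [x - y] have the same
    spectral measure, hence the same value of the form of [lap]. So the cross term vanishes and
    [lap] is block diagonal. *)
Lemma pe_lap B u : measurable B -> pe B (lap u) = lap (pe B u).
Proof.
move=> mB.
have peB := cp_sub hip (@ip_eq0 R d) (pe_cp_id B).
have peBD C := cp_add hip (@ip_eq0 R d) (pe_cp_id C).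
have peBB C := cp_sub hip (@ip_eq0 R d) (pe_cp_id C).
have offdiag x y : pe B x = x -> pe B y = 0 -> ip x (lap y) = 0.
  move=> Bx By.
  have xCy C : measurable C -> ip x (pe C y) = 0.
    move=> mC; rewrite -Bx pe_sym -pe_setI// setIC pe_setI// By.
    by rewrite -(subrr (0 : V)) peBB subrr (form_0r hip).
  have yCx C : measurable C -> ip y (pe C x) = 0.
    by move=> mC; rewrite -pe_sym (form_sym hip) xCy.
  have : ip (x + y) (lap (x + y)) = ip (x - y) (lap (x - y)).
    rewrite (ip_lapE (x + y)) (ip_lapE (x - y)).
    apply: (congr1 fine).
    apply: eq_integral_measurable => C mC.
    rewrite /smeasure peBD peBB !(formDl hip) !(formBr hip) !(form_add hip).
    by rewrite !(formNl hip) !(xCy C mC) !(yCx C mC) addr0 subr0 oppr0 opprK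
      !add0r.
  rewrite linearD linearB !(formDl hip) !(formBr hip) !(form_add hip) !(formNl
    hip).
  rewrite -[ip y (lap x)]lap_sym (form_sym hip (lap y)); lra.
have BI w : pe B (w - pe B w) = 0 by rewrite peBB pe_idem subrr.
have comp v w : ip (pe B v) (lap w) = ip (pe B v) (lap (pe B w)).
  apply/eqP; rewrite -subr_eq0 -(formBr hip) -linearB; apply/eqP.
  by apply: offdiag; rewrite ?pe_idem ?BI.
apply: (ip_inj hip (@ip_eq0 R d)) => w.
transitivity (ip (pe B w) (lap (pe B u))).
  by rewrite pe_sym (form_sym hip) comp.
by rewrite lap_sym [RHS]comp -[RHS]lap_sym [RHS](form_sym hip).
Qed.

Lemma pe_cp B : measurable B -> commuting_projection (@ip R d) (@lap R d) (pe
  B).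
Proof.
by move=> mB; split=> [u|u v|u]; [exact: pe_idem|exact: pe_sym|exact: pe_lap].
Qed.

Lemma pe_compl B u : measurable B -> pe B u = u -> pe (~` B) u = 0.
Proof.
move=> mB Bu; rewrite -Bu -pe_setI//; last exact: measurableC.
by rewrite setICl pe_set0.
Qed.

Lemma lap_bounded : exists M : R, forall u : V, pe `[- M, M]%classic u = u.
Proof.
have [M hM] := pvm_bounded hPE; exists M => u; apply: l2_eqfun.
by rewrite peE// hM//; exact: l2P.
Qed.

Lemma lap_ge : exists M : R, forall u : V, - M * ip u u <= ip u (lap u).
Proof.
have [M hM] := lap_bounded; exists M => u.
by have /andP[] := form_between (@measurable_itv _ _) (@subset_refl _ _)
  (pe_compl (@measurable_itv _ _) (hM u)).
Qed.

(** Vectors in the range have their spectral measure on [[- M, c]], those in the kernel on []c, M]].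
    The bounded support [K] enters because [form_between] asks for a bounded interval. *)
Lemma pe_cut (c : R) :
  spectral_cut (@ip R d) (@lap R d) (pe `]-oo, c]%classic) c.
Proof.
have [M hM] := lap_bounded.
set B : set R := `]-oo, c]%classic; set K : set R := `[- M, M]%classic.
have mB : measurable B by exact: measurable_itv.
have mK : measurable K by exact: measurable_itv.
have hB := pe_cp mB; split=> // u.
- have /andP[_] // : - M * ip (pe B u) (pe B u) <= ip (pe B u) (lap (pe B u)) <=
      c * ip (pe B u) (pe B u).
  apply: (@form_between (K `&` B)); first exact: measurableI.
    by move=> x []; rewrite /K /B /= !in_itv/= => /andP[-> _] ->.
  by rewrite pe_compl ?pe_setI ?pe_idem ?hM//; exact: measurableI.
- set v := u - pe B u => /=.
  have Bv : pe B v = 0 by rewrite /v (cp_sub hip (@ip_eq0 R d) hB) pe_idem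
    subrr.
  have /andP[] // : c * ip v v <= ip v (lap v) <= M * ip v v.
  apply: (@form_between (K `&` ~` B)).
  + by apply: measurableI => //; exact: measurableC.
  + move=> x []; rewrite /K /B /= !in_itv/= => /andP[_ ->] /negP.
    by rewrite -ltNge => /ltW ->.
  + rewrite setCI setCK -[v]hM -pe_setI//; last first.
      by apply: measurableU => //; exact: measurableC.
    by rewrite setIUl setICl set0U setIC pe_setI// Bv -(pe_set0 0) -pe_setI//
      setI0.
Qed.

(** On the range the form of [lap - E] vanishes, so the range consists of eigenvectors. The index
    [i0] encodes [d >= 1]: in dimension 0 the Laplacian is zero and [0] is an atom. *)
Lemma pe_atom (i0 : 'I_d) (E : R) u : pe [set E] u = 0.
Proof.
have mE : measurable [set E] by exact: measurable_set1.
pose A : {linear V -> V} := @lap R d \- (E \*: idfun)%R.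
have AE w : A w = lap w - E *: w by [].
have A_sym v w : ip (A v) w = ip v (A w).
  rewrite !AE (formBl hip) (formBr hip) lap_sym.
  by rewrite (formZl hip) (form_scale hip).
have cpA : commuting_projection (@ip R d) A (pe [set E]).
  apply: (cp_affine hip (@ip_eq0 R d) (a := 1) (b := - E)) (pe_cp mE).
  by move=> w; rewrite AE scale1r scaleNr.
apply: (@lap_no_eigenfunction _ _ i0 E); apply/eqP; rewrite -subr_eq0;
  apply/eqP.
apply: (form_eq0_op_eq0 hip (@ip_eq0 R d) A_sym cpA) => w.
rewrite AE (formBr hip) (form_scale hip); apply/eqP;
  rewrite subr_eq0 eq_sym eq_le.
apply: (@form_between [set E]) => //; first by move=> x ->;
  rewrite /= in_itv/= lexx.
by rewrite pe_compl// pe_idem.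
Qed.

Section Continuity.
Variables (i0 : 'I_d) (u : V) (E : R).

Let q c := ip (pe `]-oo, c]%classic u) (pe `]-oo, c]%classic u).

Let qE c : (q c)%:E = smeasure u `]-oo, c]%classic.
Proof. by rewrite smeasureE. Qed.

(** Continuity from above of the spectral measure along half-lines shrinking to []-oo, E]]. *)
Lemma pe_right_continuous (e : R) : 0 < e -> exists2 h, 0 < h & q (E + h) <= q
  E + e.
Proof.
move=> e0; pose F n : set R := `]-oo, E + n.+1%:R^-1]%classic.
have : smeasure u \o F @ \oo --> smeasure u (\bigcap_n F n).
  apply: nonincreasing_cvg_mu; [by rewrite /smeasure ltry|by move=> n;
    exact: measurable_itv| |].
    by apply: bigcapT_measurable => n; exact: measurable_itv.
  move=> m n mn; apply/subsetPset => x; rewrite /F /= !in_itv/= => /le_trans;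
    apply.
  by rewrite lerD2l lef_pV2 ?posrE// ler_nat.
rewrite -itvNycEbigcap -qE => /fine_cvg /cvgr_le /(_ (q E + e)).
rewrite /= ltrDl => /(_ e0) [N _ /(_ N (leqnn N))] /= le1.
exists (N.+1%:R^-1); first by rewrite invr_gt0.
by rewrite -lee_fin qE /smeasure lee_fin.
Qed.

(** The half-open intervals [F n] shrink to the point [E], a null set by [pe_atom]. *)
Lemma pe_left_continuous (e : R) : 0 < e -> exists2 h, 0 < h & q E - e <= q (E
  - h).
Proof.
move=> e0; pose F n : set R := `]E - n.+1%:R^-1, E]%classic.
have : smeasure u \o F @ \oo --> smeasure u (\bigcap_n F n).
  apply: nonincreasing_cvg_mu; [by rewrite /smeasure ltry|by move=> n;
    exact: measurable_itv| |].
    by apply: bigcapT_measurable => n; exact: measurable_itv.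
  move=> m n mn; apply/subsetPset => x; rewrite /F /= !in_itv/= => /andP[+ ->].
  rewrite andbT; apply: le_lt_trans.
  by rewrite lerD2l lerN2 lef_pV2 ?posrE// ler_nat.
rewrite -set1_bigcap_oc {2}/smeasure pe_atom// (form_0r hip).
move=> /fine_cvg /cvgr_le /(_ e e0) [N _ /(_ N (leqnn N))] /= le1.
exists (N.+1%:R^-1); rewrite ?invr_gt0// lerBlDr.
have split1 : `]-oo, E]%classic = `]-oo, E - N.+1%:R^-1]%classic `|` F N.
  by rewrite /F -itv_bndbnd_setU// bnd_simp gerBl.
rewrite -lee_fin EFinD !qE split1.
rewrite measureU; [|exact: measurable_itv|exact: measurable_itv|].
- by rewrite leeD2l// lee_fin.
- apply/seteqP; split => x // []; rewrite /F /= !in_itv/= => /le_lt_trans h.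
  by move=> /andP[/h]; rewrite ltxx.
Qed.

End Continuity.

End SpectralMeasure.

(** * Eigenvalue counting in a cube *)

Lemma mxrank_diag (F : fieldType) n (a : 'rV[F]_n) :
  \rank (diag_mx a) = (\sum_(i < n) (a 0 i != 0)%R)%N.
Proof.
elim: n a => [|n IH] a; first by rewrite [diag_mx a]flatmx0 mxrank0 big_ord0.
(* [a] is retyped over [1 + n] so that the block decomposition applies. *)
rewrite big_ord_recl; pose b : 'rV[F]_(1 + n) := a.
have -> : \rank (diag_mx a) =
    \rank (block_mx (diag_mx (lsubmx b)) 0 0 (diag_mx (rsubmx b))).
  by rewrite -diag_mx_row hsubmxK.
rewrite rank_diag_block_mx IH; congr (_ + _)%N.
  rewrite rank_rV; congr nat_of_bool; apply/idP/idP; apply: contraNN.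
    move=> /eqP a0; apply/eqP/matrixP => i j; rewrite !mxE !ord1 mulr1n /=.
    by rewrite -[RHS]a0; congr (a _ _); apply: val_inj.
  move=> /eqP/matrixP/(_ 0 0); rewrite !mxE mulr1n => a0; apply/eqP.
  by rewrite -[RHS]a0; congr (a _ _); apply: val_inj.
apply: eq_bigr => i _; rewrite mxE; congr (nat_of_bool (a _ _ != _)).
exact: val_inj.
Qed.

Section HermitianMatrix.
Local Open Scope sesquilinear_scope.
Variables (R : realType) (N : nat) (M : 'M[R[i]]_N).
Hypothesis hM : M \is hermsymmx.

Let U := spectralmx M.

(** The rows of [U] are left eigenvectors, as [U M] is the diagonal matrix times [U]; the rank of an
    eigenspace is the number of zeros on the shifted diagonal. *)
Lemma spectral_diagonalization : exists r : 'I_N -> R,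
  (forall i j, \sum_k U i k * M k j = (r i)%:C * U i j) /\
  (forall E, eigenvalue_count M E = \sum_(i < N) (r i <= E)%R)%N.
Proof.
have hD := hermitian_spectral_diag_real hM.
pose r i := complex.Re (spectral_diag M 0 i).
have dE i : spectral_diag M 0 i = (r i)%:C.
  by have /mxOverP/(_ 0 i)/RRe_real := hD.
have /orthomx_spectralP Meq := hermitian_normalmx hM; rewrite -/U in Meq.
have Uu : U \in unitmx := spectral_unit M.
have UM : U *m M = diag_mx (spectral_diag M) *m U.
  by rewrite [in LHS]Meq -mulmxA mulKVmx.
exists r; split=> [i j|E].
  have /matrixP/(_ i j) := UM; rewrite mxE => ->.
  by rewrite mul_diag_mx mxE dE.
have rankE l : \rank (eigenspace M l) = (\sum_(i < N) ((r i)%:C == l)%R)%N.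
  rewrite mxrank_ker.
  have -> : M - l%:M = invmx U *m diag_mx (spectral_diag M - const_mx l) *m U.
    rewrite (linearB (@diag_mx _ N)) /= diag_const_mx mulmxBr mulmxBl -Meq;
      congr (_ - _).
    by rewrite mul_mx_scalar -scalemxAl mulVmx// scalemx1.
  rewrite mxrankMfree ?row_free_unit// eqmxMfull ?row_full_unit ?unitmx_inv//.
  rewrite mxrank_diag.
  rewrite -[X in (X - _)%N]card_ord -sum1_card -sumnB; last by move=> i _;
    exact: leq_b1.
  apply: eq_bigr => i _; rewrite !mxE dE subr_eq0.
  by case: eqP.
(* The count is a sum over a set of complex numbers; it becomes a sum over the list of distinct
   eigenvalues, outside which the eigenspaces are trivial. *)
pose s := undup [seq (r i)%:C | i <- enum 'I_N].
have r_s i : (r i)%:C \in s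
  by rewrite mem_undup; apply/mapP; exists i; rewrite ?mem_enum.
rewrite /eigenvalue_count (@fsbig_fwiden _ _ _ _ [seq l <- s | l <= E%:C]).
- under eq_bigr do rewrite rankE.
  rewrite exchange_big; apply: eq_bigr => i _ /=.
  rewrite -lecR -[LHS]big_mkcond sum1_count.
  rewrite (eq_count (a2 := pred1 (r i)%:C)) => [|l]; last by rewrite /= eq_sym.
  by rewrite count_uniq_mem ?filter_uniq ?undup_uniq// mem_filter r_s andbT.
- move=> l /= [el lE]; rewrite mem_filter lE /=; apply: contraT => nl.
  suff : \rank (eigenspace M l) = 0%N.
    by move/eqP; rewrite mxrank_eq0; move: el; rewrite /eigenvalue => /negPf ->.
  rewrite rankE big1// => i _; case: eqP => // rl; case/negP: nl.
  by rewrite -rl.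
- by rewrite filter_uniq// undup_uniq.
- move=> l /= []; rewrite mem_filter => /andP[lE _] nl; apply/eqP.
  rewrite mxrank_eq0; apply: contraT => el; case: nl; split=> //.
Qed.

(** Unitarity of [U]; used at each lattice site separately in [sum_ip_unitary]. *)
Lemma spectral_sum_sq (x : 'I_N -> R[i]) :
  \sum_i sq (\sum_j U i j * x j) = \sum_j sq (x j).
Proof.
pose X : 'cV[R[i]]_N := \col_j x j.
have sqE (Y : 'cV[R[i]]_N) :
    (Y ^t* *m Y) 0 0 = (\sum_i sq (Y i 0))%:C.
  rewrite mxE rmorph_sum; apply: eq_bigr => i _.
  by rewrite !mxE; exact: sq_conjM.
have UU : U ^t* *m U = 1%:M.
  by rewrite -invmx_unitary ?spectral_unitarymx// mulVmx ?spectral_unit.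
have : ((U *m X) ^t* *m (U *m X)) 0 0 = (X ^t* *m X) 0 0.
  by rewrite trmx_mul map_mxM -mulmxA (mulmxA _ U) UU mul1mx.
rewrite !sqE => /complexI; under eq_bigr do rewrite mxE.
move=> e; transitivity (\sum_i sq (\sum_j U i j * X j 0)).
  by apply: eq_bigr => i _; congr sq; apply: eq_bigr => j _; rewrite mxE.
by rewrite e; apply: eq_bigr => i _; rewrite mxE.
Qed.

End HermitianMatrix.

Section ComplexLinear.
Variables (R : realType) (d : nat).
Notation V := (l2 R d).
Let hip := @ip_form R d.

(** [l2] carries real scalars only, while the entries of the diagonalizing matrix are complex;
    complex linearity is therefore stated pointwise. *)
Definition clinear (T : V -> V) := forall (a : R[i]) (u v w : V),
  (forall n, w n = a * u n + v n) -> forall n, T w n = a * T u n + T v n.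

Lemma ell2_comb (I : Type) (r : seq I) (c : I -> R[i]) (g : I -> V) :
  ell2 (fun n => \sum_(j <- r) c j * g j n).
Proof.
elim: r => [|j r IH].
  by under eq_fun do rewrite big_nil; exact: ell2_0.
under eq_fun do rewrite big_cons; apply: ell2D => //.
by apply: ell2Z; exact: l2P.
Qed.

Definition comb (I : Type) (r : seq I) (c : I -> R[i]) (g : I -> V) : V :=
  L2 (ell2_comb r c g).

Lemma clinear_comb (T : V -> V) (I : Type) (r : seq I) c (g : I -> V) :
  clinear T -> T (comb r c g) = comb r c (fun j => T (g j)).
Proof.
move=> hT; elim: r => [|j r IH]; apply: l2_inj => n /=.
  rewrite big_nil; set z := comb _ _ _.
  have -> : z = 0 by apply: l2_inj => k /=; rewrite big_nil.
  (* This instance reads [T 0 = - T 0 + T 0]. *)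
  have /(_ _ n) := hT (-1) 0 0 0.
  rewrite mulN1r addNr; apply => k; by rewrite l2_zeroE mulr0 addr0.
have /(_ _ n) := hT (c j) (g j) (comb r c g) (comb (j :: r) c g).
rewrite big_cons IH; apply => k /=; by rewrite big_cons.
Qed.

Lemma lap_clinear : clinear (@lap R d).
Proof.
move=> a u v w hw n; rewrite !(lapE Ell1) !laplacianE mulr_sumr -big_split.
by apply: eq_bigr => i _; rewrite /= !hw; ring.
Qed.

Lemma sqnorm_delta (n : site d) : sqnorm (delta R n) = 1%E.
Proof.
rewrite /sqnorm (eq_esum (b := fun k => if k \in [set n] then 1%E else 0%E)).
  by rewrite -esum_mkcond esum_set1.
move=> k _; rewrite /delta; have [->|/eqP kn] := eqVneq k n.
  by rewrite mem_set//= expr0n addr0 expr1n.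
by rewrite memNset//= expr0n addr0.
Qed.

Lemma ell2_delta (n : site d) : ell2 (delta R n).
Proof. by rewrite /ell2 sqnorm_delta ltry. Qed.

Definition dlt n : V := L2 (ell2_delta n).

Lemma dltE n k : dlt n k = (k == n)%:R. Proof. by []. Qed.

Lemma ip_dlt n : ip (dlt n) (dlt n) = 1.
Proof. by apply: EFin_inj; rewrite ipuuE sqnorm_delta. Qed.

Lemma dlt_shift n : dlt n = shift (- n) (dlt 0).
Proof. by apply: l2_inj => k; rewrite /= /delta subr_eq0. Qed.

Lemma ip_subr_le (x y : V) : ip (x - y) (x - y) <= 2 * (ip x x + ip y y).
Proof.
have := form_ge0 hip (x + y).
rewrite !(formDl hip) !(form_add hip) !(formNl hip) !(formNr hip); lra.
Qed.

End ComplexLinear.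

Section Translates.
Variables (R : realType) (d : nat) (nu : site_norm).
Variable PE : set R -> (site d -> R[i]) -> site d -> R[i].
Hypothesis hPE : is_spectral_measure (laplacian nu) PE.
Notation V := (l2 R d).
Notation pe := (pe hPE).
Notation ip := (@ip R d).
Let hip := @ip_form R d.
Let ip_eq0 := @ip_eq0 R d.

Lemma peB_clinear B : measurable B -> clinear (pe B).
Proof.
by move=> mB a u v w hw; apply: pe_clinear => //; exact/funext.
Qed.

(** [lap] commutes with translations. *)
Lemma cut_shift (Q : V -> V) c n : spectral_cut ip (@lap R d) Q c ->
  spectral_cut ip (@lap R d) (fun u => shift n (Q (shift (- n) u))) c.
Proof.
move=> hQ; have [[idem sym comm] le ge] := hQ; split=> [|u|u].
- split=> [u|u v|u]; first by rewrite shiftK idem.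
  + by rewrite ip_shiftl sym ip_shiftl opprK.
  + by rewrite -lap_shift comm -lap_shift.
- by rewrite lap_shift !ip_shift.
- rewrite /= -{1 3 5 7}(shiftNK n u) -!linearB lap_shift !ip_shift.
  exact: ge.
Qed.

Notation Q c := (pe `]-oo, c]%classic).
Lemma idsE c : ids PE c = ip (Q c (dlt R 0)) (Q c (dlt R 0)).
Proof.
by rewrite pe_sym pe_idem ip_innerE /ids peE//; exact: measurable_itv.
Qed.

(** Moving site [n] to the origin turns the projection into a translated cut at [c], which
    [cut_norm_le] compares with the cut at [c']; the strict inequality [c < c'] is the price. *)
Lemma translate_le_ids n c c' : c < c' ->
  ip (Q c (dlt R n)) (Q c (dlt R n)) <= ids PE c'.
Proof.
move=> cc'; rewrite dlt_shift -(ip_shift n) idsE.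
have := cut_norm_le hip ip_eq0 (@lap_sym R d) _
  (cut_shift n (pe_cut hPE c)) (pe_cut hPE c') cc' (dlt R 0).
by have [M hM] := lap_ge hPE; apply; exact: hM.
Qed.

Lemma ids_le_translate n c c' : c' < c ->
  ids PE c' <= ip (Q c (dlt R n)) (Q c (dlt R n)).
Proof.
move=> cc'; rewrite dlt_shift -(ip_shift n) idsE.
have := cut_norm_le hip ip_eq0 (@lap_sym R d) _
  (pe_cut hPE c') (cut_shift n (pe_cut hPE c)) cc' (dlt R 0).
by have [M hM] := lap_ge hPE; apply; exact: hM.
Qed.

End Translates.

Local Notation cube_index d L := {ffun 'I_d -> 'I_(2 * L).+1}.

(** The factor [m] on the left avoids an exponent [d - 1] on the right. *)
Lemma card_coordinate (d m : nat) (i : 'I_d) (S : {pred 'I_m}) :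
  (#|[pred k : {ffun 'I_d -> 'I_m} | k i \in S]| * m = #|S| * m ^ d)%N.
Proof.
pose F (j : 'I_d) : {pred 'I_m} := [pred x | (j == i) ==> (x \in S)].
have -> : #|[pred k : {ffun 'I_d -> 'I_m} | k i \in S]| = #|family F|.
  apply: eq_card => k; rewrite inE; apply/idP/familyP => [kS j|/(_ i)].
    rewrite /F inE. by apply/implyP => /eqP->.
  by rewrite /F inE eqxx.
have Fi : #|F i| = #|S| by apply: eq_card => x; rewrite /F inE eqxx.
have Fj j : j != i -> #|F j| = m.
  by move=> ji; rewrite -[RHS]card_ord; apply: eq_card => x;
    rewrite /F inE (negbTE ji).
rewrite card_family foldrE big_map big_enum /= (bigD1 i)//= Fi.
rewrite (eq_bigr (fun=> m)) => [|j /Fj//].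
rewrite prod_nat_const -mulnA -expnSr; congr (_ * m ^ _)%N.
rewrite (_ : #|_| = #|predC1 i|); last exact: eq_card.
by rewrite cardC1 card_ord prednK// (leq_ltn_trans _ (ltn_ord i)).
Qed.

Lemma sum_coordinate (d L : nat) (i : 'I_d) (S : {pred 'I_(2 * L).+1}) :
  ((\sum_(j < #|{: cube_index d L}|) (enum_val j i \in S)) * (2 * L).+1 =
   #|S| * #|{: cube_index d L}|)%N.
Proof.
rewrite [X in _ = (_ * X)%N]card_cube_index -(card_coordinate i).
congr (_ * _)%N.
have -> : #|[pred k : cube_index d L | k i \in S]| =
    (\sum_(k : cube_index d L) (k i \in S))%N.
  by rewrite -sum1_card big_mkcond; apply: eq_bigr => k _; rewrite inE;
    case: ifP.
by rewrite [RHS](reindex (@enum_val _ predT))//=; exact/onW_bij/enum_val_bij.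
Qed.

(** * The restriction to a cube and its defect *)

Section Cube.
Variables (R : realType) (d : nat) (nu : site_norm) (v : site d -> R) (L : nat).
Notation V := (l2 R d).
Notation ip := (@ip R d).
Notation N := #|{: cube_index d L}|.
Let hip := @ip_form R d.

Definition hopping (j k : site d) : R :=
  \sum_(i < d) ((j + unit_site i == k)%:R + (j - unit_site i == k)%:R).

Lemma hopping_sym j k : hopping j k = hopping k j.
Proof.
apply: eq_bigr => i _; rewrite addrC; congr (_%:R + _%:R).
  by rewrite subr_eq eq_sym.
by rewrite subr_eq eq_sym.
Qed.

Lemma lap_delta j k : lap (dlt R k) j = (hopping j k)%:C.
Proof.
rewrite (lapE nu) laplacianE rmorph_sum; apply: eq_bigr => i _ /=.
by rewrite rmorphD !rmorph_nat.
Qed.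

Variable A : (site d -> R[i]) -> site d -> R[i].
Hypothesis hA : forall u n, A u n = laplacian nu u n + (v n)%:C * u n.

Let M := restriction A L.

Lemma restrictionE (j k : 'I_N) : M j k =
  (hopping (cube_site j) (cube_site k) + v (cube_site j) * (j == k)%:R)%:C.
Proof.
rewrite mxE hA -(lapE nu (dlt R (cube_site k))) lap_delta.
rewrite rmorphD rmorphM /= rmorph_nat /delta; congr (_ + _ * _%:R).
by rewrite (inj_eq (@cube_site_inj _ _)).
Qed.

Lemma restriction_hermsym : M \is hermsymmx.
Proof.
rewrite qualifE expr0 scale1r; apply/eqP/matrixP => j k.
rewrite [RHS]mxE [M^T j k]mxE -[RHS]/(conjc (M k j)).
rewrite /M !restrictionE conjc_real hopping_sym eq_sym.
by have [->//|_] := eqVneq k j; rewrite !mulr0.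
Qed.

Lemma ell2_outside (u : V) : ell2 (fun n => if n \in cube L then 0 else u n).
Proof.
apply/ell2E; apply: (@absum_le _ _ _ (fun n => sq (u n))) => [n|].
  by rewrite ger0_norm ?sq_ge0//; case: ifP => //; rewrite sq0 sq_ge0.
exact: (l2P u).
Qed.

Definition outside (u : V) : V := L2 (ell2_outside u).

(* The j-th column of the Laplacian minus that of [M], extended by 0 outside
   the cube. *)
Definition defect (j : 'I_N) : V :=
  outside (lap (dlt R (cube_site j))) - v (cube_site j) *: dlt R (cube_site j).

Lemma ip_outside_le u : ip (outside u) (outside u) <= ip u u.
Proof.
rewrite -lee_fin !ipuuE; apply: le_esum => n _; rewrite lee_fin /=.
by case: ifP => // _; rewrite /= expr0n addr0 addr_ge0// sqr_ge0.
Qed.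

Definition interior (j : 'I_N) := [forall i, `|cube_site j i| < L%:Z].

(** All neighbours of an interior site belong to the cube. *)
Lemma outside_interior j : interior j ->
  outside (lap (dlt R (cube_site j))) = 0.
Proof.
move=> /forallP jint; apply: l2_inj => n /=; case: ifPn => // nL.
rewrite lap_delta /hopping big1// => i _.
have out s : n + s = cube_site j -> (forall i', `|s i'| <= 1) -> False.
  move=> ns s1; case/negP: nL; rewrite inE /cube /= => i'.
  have -> : n i' = cube_site j i' - s i' by rewrite -ns ffunE addrK.
  rewrite (le_trans (ler_normB _ _))// (le_trans (lerD (lexx _) (s1 i')))//.
  by rewrite lezD1; exact: jint.
have unit1 i' : `|unit_site i i'| <= 1 by rewrite ffunE; case: eqP.
case: eqP => [/out[]//|_]; case: eqP => [|_]; last by rewrite addr0.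
by move=> /out[] i'; rewrite ffunE normrN.
Qed.

(** A site of the cube that is not interior has a coordinate equal to [L] or [-L]; each of the [d]
    coordinates takes such a value on a fraction at most [2 / (2L + 1)] of the cube. *)
Lemma sum_not_interior :
  (\sum_(j < N) ~~ interior j)%:R <= (2 * d)%:R * (N%:R / (2 * L).+1%:R) :> R.
Proof.
rewrite mulrA ler_pdivlMr ?ltr0n// -!natrM ler_nat.
(* After the translation by [L], the coordinates [-L] and [L] have indices [0] and [2 * L]. *)
pose S : {pred 'I_(2 * L).+1} := pred2 ord0 ord_max.
apply: (@leq_trans ((\sum_(i < d) \sum_(j < N) (enum_val j i \in S)) * (2 *
  L).+1)).
  rewrite leq_mul2r; apply/orP; right; rewrite exchange_big leq_sum// => j _.
  have [//|/forallPn[k]] := boolP (interior j).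
  rewrite -leNgt ffunE (bigD1 k)//= => Lj.
  suff -> : enum_val j k \in S by [].
  rewrite inE -!val_eqE /=; have := ltn_ord (enum_val j k).
  by move: (nat_of_ord _) Lj => x; lia.
rewrite big_distrl /= (leq_trans (n := \sum_(i < d) (2 * N)%N))//.
  apply: leq_sum => i _; rewrite sum_coordinate leq_mul//.
  by rewrite card2; case: eqP.
by rewrite sum_nat_const card_ord mulnA (mulnC d).
Qed.

End Cube.

(** * Two-sided bounds on the eigenvalue count *)

Section CountBounds.
Variables (R : realType) (d : nat) (nu : site_norm).
Variable PE : set R -> (site d -> R[i]) -> site d -> R[i].
Hypothesis hPE : is_spectral_measure (laplacian nu) PE.
Variables (v : site d -> R) (A : (site d -> R[i]) -> site d -> R[i]).
Hypothesis hA : forall u n, A u n = laplacian nu u n + (v n)%:C * u n.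
Variable L : nat.
Notation V := (l2 R d).
Notation ip := (@ip R d).
Notation N := #|{: cube_index d L}|.
Notation Q c := (pe hPE `]-oo, c]%classic).
Let hip := @ip_form R d.
Let M : 'M[R[i]]_N := restriction A L.
Let hM : M \is hermsymmx := restriction_hermsym L hA.
Let U := spectralmx M.

Let unitary_comb (i : 'I_N) (g : 'I_N -> V) : V :=
  comb (index_enum 'I_N) (fun j => U i j) g.

(** Lets a sum of squared norms be computed in the eigenbasis or in the standard basis. *)
Lemma sum_ip_unitary (g : 'I_N -> V) :
  \sum_i ip (unitary_comb i g) (unitary_comb i g) = \sum_j ip (g j) (g j).
Proof.
apply: EFin_inj; rewrite -!sumEFin.
under eq_bigr do rewrite ipuuE.
under [RHS]eq_bigr do rewrite ipuuE.
rewrite -!esum_sum; try by move=> n k _ _; rewrite lee_fin addr_ge0// sqr_ge0.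
apply: eq_esum => n _; rewrite !sumEFin; congr EFin.
exact: (spectral_sum_sq M (fun j => g j n)).
Qed.

Let vec i : V := unitary_comb i (fun j => dlt R (cube_site j)).

Let vec_in i k : vec i (cube_site k) = U i k.
Proof.
rewrite /= (bigD1 k)//= /delta eqxx mulr1 big1 ?addr0// => j jk.
by rewrite (inj_eq (@cube_site_inj _ _)) eq_sym (negbTE jk) mulr0.
Qed.

Let vec_out i n : n \notin cube L -> vec i n = 0.
Proof.
move=> nL; rewrite /= big1// => j _; rewrite /delta; case: eqP => [nj|_].
  by case/negP: nL; rewrite nj -range_cube_site inE; exists j.
by rewrite mulr0.
Qed.

Let inP n : n \in cube L -> exists k : 'I_N, n = cube_site k.
Proof. by rewrite -range_cube_site inE => -[k _ <-]; exists k. Qed.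

Let ip_vec i : ip (vec i) (vec i) = 1.
Proof.
have U1 : \sum_j sq (U i j) = 1.
  have /unitarymxP/matrixP/(_ i i) := spectral_unitarymx M.
  rewrite !mxE eqxx => e1; apply: complexI; rewrite -[RHS]e1 rmorph_sum.
  apply: eq_bigr => j _; rewrite !mxE mulrC -/U; exact/esym/sq_conjM.
(* Each factor 1 becomes the squared norm of a [dlt], so that both sides can be compared site by
   site. *)
rewrite -[RHS]U1 -[in RHS](eq_bigr _ (fun j _ => mulr1 (sq (U i j)))).
apply: EFin_inj; rewrite ipuuE -sumEFin.
have -> : (\sum_j (sq (U i j) * 1)%:E =
  \sum_j \esum_(n in [set: site d]) (sq (U i j) * sq (dlt R (cube_site j)
    n))%:E)%E.
  apply: eq_bigr => j _; rewrite esumZ ?sq_ge0//; last by move=> n;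
    exact: sq_ge0.
  by rewrite EFinM -[in LHS](ip_dlt R (cube_site j)) ipuuE.
rewrite -esum_sum; last by move=> n j _ _; rewrite lee_fin mulr_ge0// sq_ge0.
apply: eq_esum => n _; rewrite sumEFin; congr EFin; rewrite -/(sq (vec i n)).
have [nL|nL] := boolP (n \in cube L); last first.
  rewrite vec_out// sq0 big1// => j _; rewrite dltE; case: eqP => [nj|_].
    by case/negP: nL; rewrite nj -range_cube_site inE; exists j.
  by rewrite sq0 mulr0.
have [k ->] := inP nL; rewrite vec_in (bigD1 k)//= big1 ?addr0 => [|j jk].
  by rewrite /= /delta eqxx /sq /= expr1n expr0n addr0 mulr1.
by rewrite /= /delta (inj_eq (@cube_site_inj _ _)) eq_sym (negbTE jk) sq0 mulr0.
Qed.

Variables (r : 'I_N -> R).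
Hypothesis hr : forall i j, \sum_k U i k * M k j = (r i)%:C * U i j.
Hypothesis hcount : forall E, eigenvalue_count M E = (\sum_(i < N) (r i <=
  E)%R)%N.

(** In the cube [r i *: vec i] is [M] applied to [vec i], which cancels the Laplacian and leaves
    minus the potential; outside, [vec i] vanishes and only the Laplacian remains. *)
Let vec_defect i :
  lap (vec i) - r i *: vec i = unitary_comb i (@defect R d v L).
Proof.
apply: l2_inj => n; rewrite l2_subE l2_scaleE /vec /unitary_comb.
rewrite (clinear_comb _ _ _ (@lap_clinear R d)) /=.
have [nL|nL] := boolP (n \in cube L).
  have [k nk] := inP nL; rewrite -[X in _ - _ * X]/(vec i n) nk vec_in -hr
    -sumrB.
  apply: eq_bigr => j _; rewrite sub0r -mulrBr; congr (_ * _).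
  rewrite (restrictionE hA) (lap_delta R nu) [delta _ _ _]/(_ == _)%:R.
  (* The rows of [U] multiply [M] from the left, while columns of the Laplacian enter here; symmetry
     reconciles the two. *)
  rewrite (inj_eq (@cube_site_inj _ _)) hopping_sym.
  rewrite (eq_sym k); have [->|_] := eqVneq j k.
    by rewrite !mulr1 rmorphD/= opprD addrA subrr sub0r.
  by rewrite !mulr0 addr0 subrr oppr0.
rewrite -[X in _ - _ * X]/(vec i n) vec_out// mulr0 subr0.
apply: eq_bigr => j _; congr (_ * _); rewrite /delta; case: eqP => [nj|_].
  by case/negP: nL; rewrite nj -range_cube_site inE; exists j.
by rewrite mulr0 subr0.
Qed.

Let G := \sum_(j < N) ip (@defect R d v L j) (defect v j).

Let G_sum : \sum_i ip (lap (vec i) - r i *: vec i) (lap (vec i) - r i *: vec i)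
  = G.
Proof. by under eq_bigr do rewrite vec_defect; exact: sum_ip_unitary. Qed.

Let Q_sum c : \sum_i ip (Q c (vec i)) (Q c (vec i)) =
  \sum_(j < N) ip (Q c (dlt R (cube_site j))) (Q c (dlt R (cube_site j))).
Proof.
rewrite -[RHS]sum_ip_unitary; apply: eq_bigr => i _.
rewrite /vec /unitary_comb.
by rewrite (clinear_comb _ _ _ (peB_clinear hPE (@measurable_itv _ _))).
Qed.

Let countE E : (eigenvalue_count M E)%:R = \sum_i (r i <= E)%R%:R :> R.
Proof. by rewrite hcount natr_sum. Qed.

(** For [r i <= E] the unit norm of [vec i] splits by Pythagoras, and [cut_above_bound] controls the
    part off the range. One [h] is this gap, the other pays for the strict inequality in
    [translate_le_ids]. *)
Lemma count_le (E h : R) : 0 < h ->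
  (eigenvalue_count M E)%:R <= N%:R * ids PE (E + h + h) + h ^- 2 * G.
Proof.
move=> h0; have h20 : 0 < h ^+ 2 by rewrite exprn_gt0.
apply: (@le_trans _ _ (\sum_i ip (Q (E + h) (vec i)) (Q (E + h) (vec i)) + h ^-
  2 * G)).
  rewrite countE -G_sum mulr_sumr -big_split; apply: ler_sum => i _ /=.
  have cut := pe_cut hPE (E + h).
  have [rE|_] := leP (r i) E; last first.
    by rewrite addr_ge0 ?mulr_ge0 ?invr_ge0 ?(ltW h20)// (form_ge0 hip).
  rewrite -[X in X <= _](ip_vec i) (cp_pythagoras hip (cut_cp cut) (vec i))
    lerD2l.
  rewrite -(ler_pM2l h20) mulVKf ?gt_eqF//.
  by apply: (cut_above_bound hip (@ip_eq0 R d) _ cut h0); rewrite lerD2r.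
rewrite lerD2r Q_sum mulr_natl -[X in _ *+ X]card_ord -sumr_const.
by apply: ler_sum => j _; apply: translate_le_ids; rewrite ltrDl.
Qed.

(** For [r i <= E] the projected norm is at most 1, which the count supplies; for the other indices
    [cut_below_bound] charges it to the defect. *)
Lemma count_ge (E h : R) : 0 < h ->
  N%:R * ids PE (E - h - h) <= (eigenvalue_count M E)%:R + h ^- 2 * G.
Proof.
move=> h0; have h20 : 0 < h ^+ 2 by rewrite exprn_gt0.
apply: (@le_trans _ _ (\sum_i ip (Q (E - h) (vec i)) (Q (E - h) (vec i)))).
  rewrite Q_sum mulr_natl -[X in _ *+ X]card_ord -sumr_const.
  by apply: ler_sum => j _; apply: ids_le_translate; rewrite gtrBl.
rewrite countE -G_sum mulr_sumr -big_split; apply: ler_sum => i _ /=.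
have cut := pe_cut hPE (E - h).
have [rE|rE] := leP (r i) E.
  rewrite -[1%:R](ip_vec i) ler_wpDr ?(cp_le hip (cut_cp cut))//.
  by rewrite mulr_ge0 ?invr_ge0 ?(ltW h20)// (form_ge0 hip).
rewrite add0r -(ler_pM2l h20) mulVKf ?gt_eqF//.
by apply: (cut_below_bound hip (@ip_eq0 R d) _ cut h0); rewrite lerD2r ltW.
Qed.

End CountBounds.

(** * Averages of the random potential *)

Section CubeAverage.
Variables (R : realType) (d : nat).
Implicit Types (f : site d -> R) (L : nat).

Definition cube_average f L : R :=
  (\sum_(j < #|{: cube_index d L}|) f (cube_site j)) / #|{: cube_index d L}|%:R.

Lemma card_cube_gt0 L : 0 < #|{: cube_index d L}|%:R :> R.
Proof. by rewrite ltr0n card_cube_index expn_gt0. Qed.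

Lemma cube_average_ge0 f L : (forall n, 0 <= f n) -> 0 <= cube_average f L.
Proof. by move=> f0; rewrite divr_ge0 ?ler0n// sumr_ge0. Qed.

Lemma sum_cube_le f L L' : (forall n, 0 <= f n) -> (L <= L')%N ->
  \sum_(j < #|{: cube_index d L}|) f (cube_site j) <=
  \sum_(j < #|{: cube_index d L'}|) f (cube_site j).
Proof.
move=> f0 LL'.
have ex (j : 'I_#|{: cube_index d L}|) :
    exists k : 'I_#|{: cube_index d L'}|, cube_site k = cube_site j.
  have : cube L' (cube_site j).
    have : cube L (cube_site j) by rewrite -range_cube_site; exists j.
    by move=> h i; rewrite (le_trans (h i))// lez_nat.
  by rewrite -range_cube_site => -[k _ kj]; exists k.
pose g j := sval (cid (ex j)).
have gE j : cube_site (g j) = cube_site j by rewrite /g; case: cid.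
have g_inj : injective g.
  by move=> j k gjk; apply: (@cube_site_inj d L); rewrite -!gE gjk.
have -> : \sum_(j < #|{: cube_index d L}|) f (cube_site j) =
    \sum_(k <- map g (enum 'I_#|{: cube_index d L}|)) f (cube_site k).
  by rewrite big_map big_enum; apply: eq_bigr => j _; rewrite gE.
rewrite big_uniq ?(map_inj_uniq g_inj) ?enum_uniq//=.
by rewrite [leRHS](bigID (mem (map g (enum 'I_#|{: cube_index d L}|))))/= lerDl
  sumr_ge0.
Qed.

Lemma cube_average_le f L L' (c : nat) : (forall n, 0 <= f n) -> (L <= L')%N ->
  ((2 * L').+1 <= c * (2 * L).+1)%N ->
  cube_average f L <= (c ^ d)%:R * cube_average f L'.
Proof.
move=> f0 LL' L'c; rewrite /cube_average mulrA ler_pdivlMr ?card_cube_gt0//.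
rewrite mulrAC ler_pdivrMr ?card_cube_gt0// [_ * \sum_(_ < _) _]mulrC
  -[leRHS]mulrA.
apply: ler_pM => //; [exact: sumr_ge0|exact: sum_cube_le|].
rewrite -natrM ler_nat !card_cube_index -expnMn.
by have [->|d0] := posnP d; rewrite ?expn0// leq_exp2r.
Qed.

(** Any [L > 0] lies between consecutive powers of 4, and passing to the larger cube costs a factor
    at most [4 ^ d] for nonnegative [f]. *)
Lemma cube_average_cvg0 f : (forall n, 0 <= f n) ->
  (fun k => cube_average f (4 ^ k)) @ \oo --> (0 : R) ->
  (fun L => cube_average f L) @ \oo --> (0 : R).
Proof.
move=> f0 /cvgr0Pnorm_le fk; apply/cvgr0Pnorm_le => e e0.
have c0 : 0 < (4 ^ d)%:R :> R by rewrite ltr0n expn_gt0.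
have [K _ hK] := fk (e / (4 ^ d)%:R) (divr_gt0 e0 c0).
exists (4 ^ K)%N => // L /= KL.
have L0 : (0 < L)%N by apply: leq_trans KL; rewrite expn_gt0.
have /andP[kL Lk] := trunc_log_bounds (isT : (1 < 4)%N) L0.
set k := trunc_log 4 L in kL Lk.
have Kk : (K <= k.+1)%N.
  by rewrite leqW// trunc_log_max.
rewrite ger0_norm ?cube_average_ge0//.
apply: le_trans (cube_average_le (c := 4) f0 (ltnW Lk) _) _.
  by rewrite expnS; lia.
rewrite mulrC -ler_pdivlMr//.
by have := hK k.+1 Kk; rewrite /= ger0_norm ?cube_average_ge0.
Qed.

Section Weights.
Variables (i0 : 'I_d) (nu : site_norm) (alpha : R).
Hypothesis alpha0 : 0 < alpha.

Definition weight (n : site d) : R := ((1 + snorm R nu n) `^ alpha) ^- 2.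

Lemma snorm_ge (n : site d) : `|n i0|%:~R <= snorm R nu n.
Proof.
case: nu; rewrite /snorm; last first.
  by rewrite (bigD1 i0)//= intr_norm lerDl sumr_ge0.
rewrite intr_norm -sqrtr_sqr ler_wsqrtr// (bigD1 i0)//= lerDl.
by rewrite sumr_ge0// => i _; exact: sqr_ge0.
Qed.

Lemma snorm_ge0 (n : site d) : 0 <= snorm R nu n.
Proof. by apply: le_trans (snorm_ge n); rewrite ler0z. Qed.

Lemma weight_ge0 n : 0 <= weight n.
Proof. by rewrite invr_ge0 sqr_ge0. Qed.

Lemma weight_le (x : R) n : 0 <= x -> x <= snorm R nu n ->
  weight n <= ((1 + x) `^ alpha) ^- 2.
Proof.
move=> x0 xn; have p0 y : 0 <= y -> 0 < (1 + y) `^ alpha.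
  by move=> y0; rewrite powR_gt0// ltr_wpDr.
rewrite lef_pV2 ?posrE ?exprn_gt0 ?p0 ?snorm_ge0//.
rewrite lerXn2r ?nnegrE ?(ltW (p0 _ _)) ?snorm_ge0//.
by rewrite ge0_ler_powR ?(ltW alpha0)// ?nnegrE ?addr_ge0 ?snorm_ge0// lerD2l.
Qed.

(** Inside the slab where coordinate [i0] is at most [K] in absolute value the weight is at most 1,
    and the slab fills a fraction at most [(2K + 1) / (2L + 1)] of the cube; outside it the norm
    exceeds [K]. *)
Lemma weight_average_le L K :
  cube_average weight L <=
  (2 * K).+1%:R / (2 * L).+1%:R + ((1 + K%:R) `^ alpha) ^- 2.
Proof.
(* The condition [|x - L| <= K] written without subtraction of natural numbers. *)
pose S : {pred 'I_(2 * L).+1} :=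
  [pred x : 'I_(2 * L).+1 | (L <= x + K)%N && (x <= L + K)%N].
have card_S : (#|S| <= (2 * K).+1)%N.
  rewrite cardE -(size_map val) -(size_iota (L - K) (2 * K).+1).
  apply: uniq_leq_size => [|x].
    by rewrite map_inj_uniq ?enum_uniq//; exact: val_inj.
  by move=> /mapP[y]; rewrite mem_enum inE mem_iota => yS -> /=; lia.
have nearE (j : 'I_#|{: cube_index d L}|) :
    `|cube_site j i0| <= K%:Z -> enum_val j i0 \in S.
  rewrite ffunE inE; move: (nat_of_ord _) => x; lia.
rewrite /cube_average ler_pdivrMr ?card_cube_gt0// mulrDl.
apply: (@le_trans _ _ (\sum_(j < #|{: cube_index d L}|)
    ((enum_val j i0 \in S)%:R + ((1 + K%:R) `^ alpha) ^- 2))).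
  apply: ler_sum => j _.
  have [/nearE ->|jK] := leP `|cube_site j i0| K%:Z.
    rewrite ler_wpDr ?invr_ge0 ?sqr_ge0//.
    have := weight_le (lexx 0) (snorm_ge0 (cube_site j)).
    by rewrite addr0 powR1 expr1n invr1.
  rewrite ler_wpDl ?ler0n// weight_le ?ler0n//.
  by apply: le_trans (snorm_ge _); rewrite pmulrn ler_int ltW.
rewrite big_split /= sumr_const card_ord -[X in _ + X]mulr_natr lerD2r.
rewrite -natr_sum mulrAC ler_pdivlMr ?ltr0n// -!natrM ler_nat.
by rewrite sum_coordinate leq_mul.
Qed.

End Weights.

End CubeAverage.

Lemma geometric_sum_le (R : realFieldType) (x : R) n : 0 <= x < 1 ->
  \sum_(k < n) x ^+ k <= (1 - x)^-1.
Proof.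
move=> /andP[x0 x1]; have x1' : 0 < 1 - x by rewrite subr_gt0.
rewrite -[leRHS]mul1r ler_pdivlMr// mulrC -opprB mulNr -subrX1 opprB.
by rewrite gerBl exprn_ge0.
Qed.

(** * Almost sure decay of the averaged squared potential *)

Section RandomPotential.
Variables (R : realType) (d : nat) (i0 : 'I_d) (nu : site_norm) (alpha : R).
Hypothesis alpha0 : 0 < alpha.
Variables (dd : measure_display) (T : measurableType dd) (P : probability T R).
Variable X : site d -> {RV P >-> R}.
Hypothesis X_dist : forall i j (B : set R), measurable B ->
  distribution P (X i) B = distribution P (X j) B.
Hypothesis X2 : ('E_P[(fun w => X 0 w ^+ 2)%R] < +oo)%E.
Notation weight := (@weight R d nu alpha).

Let mX2 n : measurable_fun setT (fun w => (X n w ^+ 2)%:E).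
Proof. by apply/measurable_EFinP; exact: measurable_funX. Qed.

Let sigma2 := fine 'E_P[(fun w => X 0 w ^+ 2)%R].

(** The integral is moved to the law of [X n], and these laws agree on measurable sets. *)
Lemma second_moment n : (\int[P]_w (X n w ^+ 2)%:E = sigma2%:E)%E.
Proof.
have mom k : (\int[P]_w (X k w ^+ 2)%:E =
    \int[distribution P (X k)]_y (y ^+ 2)%:E)%E.
  rewrite ge0_integral_distribution//.
    by apply/measurable_EFinP; exact: measurable_funX.
  by move=> y; rewrite lee_fin sqr_ge0.
have -> : (\int[P]_w (X n w ^+ 2)%:E = \int[P]_w (X 0 w ^+ 2)%:E)%E.
  by rewrite !mom; apply: eq_integral_measurable => B; exact: X_dist.
rewrite /sigma2 fineK unlock//.
move: X2; rewrite unlock => X2'; rewrite ge0_fin_numE//.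
by apply: integral_ge0 => w _; rewrite lee_fin sqr_ge0.
Qed.

Let sigma2_ge0 : 0 <= sigma2.
Proof.
by rewrite -lee_fin -(second_moment 0) integral_ge0// => w _;
  rewrite lee_fin sqr_ge0.
Qed.

Let potential2 w n := X n w ^+ 2 * weight n.

Let potential2_ge0 w n : 0 <= potential2 w n.
Proof. by rewrite mulr_ge0 ?sqr_ge0// weight_ge0. Qed.

Let Z k w := cube_average (potential2 w) (4 ^ k).

Let Z_ge0 k w : 0 <= Z k w.
Proof. exact: cube_average_ge0. Qed.

Let mZ k : measurable_fun setT (fun w => (Z k w)%:E).
Proof.
apply/measurable_EFinP; apply: measurable_funM => //.
apply: measurable_sum => j; apply: measurable_funM => //.
exact: measurable_funX.
Qed.

Let int_Z k : (\int[P]_w (Z k w)%:E = (sigma2 * cube_average weight (4 ^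
  k))%:E)%E.
Proof.
pose c (j : 'I_#|{: cube_index d (4 ^ k)}|) :=
  weight (cube_site j) / #|{: cube_index d (4 ^ k)}|%:R.
have c0 j : 0 <= c j by rewrite divr_ge0 ?weight_ge0.
have -> : (fun w => (Z k w)%:E) =
    (fun w => \sum_j ((c j)%:E * (X (cube_site j) w ^+ 2)%:E))%E.
  apply/funext => w; rewrite /Z /cube_average mulr_suml -sumEFin.
  by apply: eq_bigr => j _; rewrite -EFinM /potential2 /c -mulrA mulrC.
rewrite ge0_integral_sum//; last 2 first.
- by move=> j; exact: measurable_funeM.
- by move=> j w _; rewrite -EFinM lee_fin mulr_ge0// sqr_ge0.
under eq_bigr => j _.
  rewrite ge0_integralZl_EFin//; last by move=> w _; rewrite lee_fin sqr_ge0.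
  rewrite second_moment -EFinM; over.
by rewrite sumEFin -mulr_suml /cube_average -mulr_suml mulrC.
Qed.

Let rho : R := (2 `^ alpha) ^- 2.

Let rho01 : 0 <= rho < 1.
Proof.
rewrite invr_ge0 sqr_ge0 /= invf_lt1 ?exprn_gt0 ?powR_gt0// exprn_egt1//.
have := gt0_ltr_powR alpha0 (ler01 : 1 \is Num.nneg) (ler0n R 2) (ltr1n R 2).
by rewrite powR1.
Qed.

Let weight_le_geometric k :
  cube_average weight (4 ^ k) <= 2 * 2^-1 ^+ k + rho ^+ k.
Proof.
(* With [K = 2 ^ k], the square root of the side [4 ^ k], both the slab fraction and the weight off
   the slab decay geometrically. *)
apply: le_trans (weight_average_le i0 nu alpha0 (4 ^ k) (2 ^ k)) _.
apply: lerD.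
  rewrite ler_pdivrMr ?ltr0n// exprVn mulrAC ler_pdivlMr ?exprn_gt0//.
  rewrite -natrX -!natrM ler_nat (_ : 4 = 2 * 2)%N// expnMn.
  by have : (0 < 2 ^ k)%N by [rewrite expn_gt0]; nia.
rewrite /rho exprVn lef_pV2 ?posrE ?exprn_gt0 ?powR_gt0 ?ltr_wpDr//.
rewrite -exprM mulnC exprM lerXn2r ?nnegrE ?exprn_ge0 ?powR_ge0//.
rewrite -powR_mulrn ?powR_ge0// -powRrM mulrC powRrM powR_mulrn//.
by rewrite ge0_ler_powR ?(ltW alpha0)// ?nnegrE ?exprn_ge0 ?addr_ge0// natrX
  lerDr.
Qed.

(** [Y] has a finite integral, so it is finite almost surely and the terms of its series tend to 0;
    [cube_average_cvg0] extends this from powers of 4 to all [L]. *)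
Lemma random_potential_average :
  {ae P, forall w, (fun L => cube_average (potential2 w) L) @ \oo --> (0 : R)}.
Proof.
pose Y w := (\sum_(k <oo) (Z k w)%:E)%E.
(* The sums of the two geometric series in [weight_le_geometric]. *)
pose C : R := sigma2 * (2 * (1 - 2^-1)^-1 + (1 - rho)^-1).
have intY : (\int[P]_w Y w <= C%:E)%E.
  rewrite integral_nneseries//; last by move=> k w _; rewrite lee_fin.
  apply: lime_le; first by apply: is_cvg_nneseries => k _ _;
    rewrite integral_ge0// => w _; rewrite lee_fin.
  apply: nearW => n; rewrite big_mkord; under eq_bigr do rewrite int_Z.
  rewrite sumEFin lee_fin -mulr_sumr ler_wpM2l//.
  apply: (@le_trans _ _ (\sum_(k < n) (2 * 2^-1 ^+ k + rho ^+ k))).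
    by apply: ler_sum => k _; exact: weight_le_geometric.
  rewrite big_split /= -mulr_sumr lerD ?ler_wpM2l ?geometric_sum_le//.
  by rewrite invr_ge0 ler0n /= invf_lt1// ltr1n.
have Y0 w : (0 <= Y w)%E by apply: nneseries_ge0 => k _ _; rewrite lee_fin.
have iY : P.-integrable setT Y.
  apply/integrableP; split.
    by apply: ge0_emeasurable_sum => // k w _ _; rewrite lee_fin.
  under eq_integral do rewrite gee0_abs//.
  exact: le_lt_trans intY (ltry _).
have := integrable_ae measurableT iY; apply: filterS => w /(_ I) Yfin.
apply: cube_average_cvg0 => //; apply: cvg_series_cvg_0.
apply: nondecreasing_is_cvgn.
  by apply/nondecreasing_seqP => n; rewrite seriesSr lerDl; exact: Z_ge0.
exists (fine (Y w)) => _ [n _ <-].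
rewrite -lee_fin fineK// seriesEnat -sumEFin.
by apply: nneseries_lim_ge => k _ _; rewrite lee_fin; exact: Z_ge0.
Qed.

End RandomPotential.

(** * Convergence of the normalised eigenvalue count *)

Section Convergence.
Variables (R : realType) (d : nat) (i0 : 'I_d) (nu : site_norm).
Variable PE : set R -> (site d -> R[i]) -> site d -> R[i].
Hypothesis hPE : is_spectral_measure (laplacian nu) PE.
Variables (v : site d -> R) (A : (site d -> R[i]) -> site d -> R[i]).
Hypothesis hA : forall u n, A u n = laplacian nu u n + (v n)%:C * u n.
Notation ip := (@ip R d).
Notation N L := (#|{: cube_index d L}|%:R : R).
Let hip := @ip_form R d.

Let defect_sum L := \sum_(j < #|{: cube_index d L}|) ip (@defect R d v L j)
  (defect v j).

(** Columns at interior sites contain only the potential; at the other sites the Laplacian part has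
    at most the norm of [lap (dlt R 0)], by translation. *)
Let defect_le L : defect_sum L / N L <=
  2 * (ip (lap (dlt R 0)) (lap (dlt R 0)) * ((2 * d)%:R / (2 * L).+1%:R) +
       cube_average (fun n => v n ^+ 2) L).
Proof.
set C0 := ip _ _; have N0 : 0 < N L by exact: card_cube_gt0.
have C00 : 0 <= C0 by exact: form_ge0 hip _.
rewrite ler_pdivrMr//.
apply: (@le_trans _ _ (\sum_(j < #|{: cube_index d L}|)
    2 * (C0 * (~~ interior j)%:R + v (cube_site j) ^+ 2))).
  apply: ler_sum => j _; apply: le_trans (ip_subr_le _ _) _.
  rewrite ler_wpM2l// (formZl hip) (form_scale hip) ip_dlt mulr1 -expr2 lerD2r.
  have [jint|_] := boolP (interior j).
    by rewrite (outside_interior R nu jint) (form_0r hip) mulr0.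
  by rewrite mulr1 (le_trans (ip_outside_le _ _))// dlt_shift lap_shift
    ip_shift.
rewrite -mulr_sumr -mulrA ler_wpM2l// big_split /= mulrDl.
rewrite /cube_average divfK ?gt_eqF// lerD2r -mulr_sumr -natr_sum -mulrA.
rewrite ler_wpM2l// (le_trans (sum_not_interior _ _ _))//.
by rewrite le_eqVlt; apply/orP; left; apply/eqP; ring.
Qed.

Hypothesis v_average :
  (fun L => cube_average (fun n => v n ^+ 2) L) @ \oo --> (0 : R).

Let defect_cvg0 : (fun L => defect_sum L / N L) @ \oo --> (0 : R).
Proof.
pose b L := 2 * (ip (lap (dlt R 0)) (lap (dlt R 0)) * ((2 * d)%:R / (2 *
  L).+1%:R) +
       cube_average (fun n => v n ^+ 2) L).
apply: (@squeeze_cvgr _ _ _ _ (fun=> 0) b).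
- apply: nearW => L; rewrite defect_le andbT divr_ge0 ?ler0n// sumr_ge0// =>
  j _.
  exact: form_ge0 hip _.
- exact: cvg_cst.
- rewrite -[X in _ --> X](mulr0 2) -[X in 2 * X](addr0 0) -[X in 2 * (X +
  _)](mulr0 (ip (lap (dlt R 0)) (lap (dlt R 0)))).
  apply: cvgMr; apply: cvgD => //; apply: cvgMr.
  rewrite -[X in _ --> X](mulr0 (2 * d)%:R); apply: cvgMr.
  apply: (@squeeze_cvgr _ _ _ _ (fun=> 0) (fun L => L.+1%:R^-1)).
  + apply: nearW => L; rewrite invr_ge0 ler0n/= lef_pV2 ?posrE// ler_nat.
    by rewrite ltnS leq_pmull.
  + exact: cvg_cst.
  + exact: cvg_harmonic.
Qed.

Lemma count_cvg E : (fun L =>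
  (eigenvalue_count (restriction A L) E)%:R / N L) @ \oo --> ids PE E.
Proof.
apply/cvgrPdist_le => e e0.
have e20 : 0 < e / 2 by rewrite divr_gt0.
have half (h : R) : h / 2 + h / 2 = h by rewrite -splitr.
(* [h] and [k] keep the variation of the density of states within [e / 2] on either side of [E]; the
   other [e / 2] is left for the defect. *)
have [h h0] := pe_right_continuous hPE (dlt R 0) E e20; rewrite -!idsE => hq.
have [k k0] := pe_left_continuous hPE i0 (dlt R 0) E e20; rewrite -!idsE => kq.
have small (x : R) : 0 < x -> \forall L \near \oo,
    (x / 2) ^- 2 * (defect_sum L / N L) <= e / 2.
  move=> x0; have c0 : 0 < (x / 2) ^+ 2 by rewrite exprn_gt0// divr_gt0.
  have /cvgr_le/(_ _ (mulr_gt0 c0 e20)) := defect_cvg0.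
  by apply: filterS => L dL; rewrite ler_pdivrMl.
near=> L.
have N0 : 0 < N L by exact: card_cube_gt0.
have [r [hr hc]] := spectral_diagonalization (restriction_hermsym L hA).
(* [count_le] and [count_ge] move the energy by twice their parameter, hence the halves. *)
have up := count_le hPE hA hr hc E (divr_gt0 h0 (ltr0n _ 2)).
have lo := count_ge hPE hA hr hc E (divr_gt0 k0 (ltr0n _ 2)).
have sh : (h / 2) ^- 2 * (defect_sum L / N L) <= e / 2 by near: L; exact: small.
have sk : (k / 2) ^- 2 * (defect_sum L / N L) <= e / 2 by near: L; exact: small.
move: up lo; rewrite -addrA half -addrA -opprD half -/(defect_sum L).
move: (eigenvalue_count _ _)%:R => c up lo.
have {up} upN : c / N L <= ids PE (E + h) + (h / 2) ^- 2 * (defect_sum L / N L).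
  by rewrite ler_pdivrMr// mulrDl -[_ * _ * N L]mulrA divfK ?gt_eqF// [ids _ _
    * _]mulrC.
have {lo} loN : ids PE (E - k) <= c / N L + (k / 2) ^- 2 * (defect_sum L / N L).
  rewrite -(ler_pM2r N0) mulrDl divfK ?gt_eqF// -[_ * _ * N L]mulrA.
  by rewrite divfK ?gt_eqF// mulrC.
rewrite ler_distl; lra.
Unshelve. all: by end_near. Qed.

End Convergence.

Theorem theorem1p1 (R : realType) (d : nat) (hd : (1 <= d)%N)
    (nu : site_norm) (alpha : R) (halpha : 0 < alpha)
    (dd : measure_display) (T : measurableType dd) (P : probability T R)
    (X : site d -> {RV P >-> R}) (hX : iid X)
    (hX2 : ('E_P[(fun w => X 0 w ^+ 2)%R] < +oo)%E)
    (PE : set R -> (site d -> R[i]) -> site d -> R[i])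
    (hPE : is_spectral_measure (laplacian nu) PE) :
  {ae P, forall w : T, forall E : R,
    (fun L : nat =>
       (eigenvalue_count
          (restriction (hamiltonian nu alpha (fun n => X n w)) L) E)%:R
         / (((2 * L).+1 ^ d)%N)%:R) @ \oo --> ids PE E}.
Proof.
have i0 : 'I_d by exists 0%N.
(* The exceptional null set comes from the averages and is fixed before [E] is introduced. *)
have := random_potential_average i0 nu halpha hX.2 hX2.
apply: filterS => w Xw E.
under eq_fun => L do rewrite -card_cube_index.
apply: (count_cvg i0 hPE (v := fun n => X n w / (1 + snorm R nu n) `^ alpha)).
  by [].
by under eq_fun do under eq_fun do rewrite expr_div_n.
Qed.
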